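(* Let $p \geq 2$ be a prime number and let $\mathcal{K}_p^s$ be the family of cyclic number fields $K$ of degree $p$ over $\mathbb{Q}$, where for $p=2$ one fixes a signature $s \in \{+1,-1\}$ (i.e. one considers only real quadratic fields, or only imaginary quadratic fields), and for $p>2$ all such fields are (necessarily) real. For $K \in \mathcal{K}_p^s$ let $f = f_K$ be its conductor, $D = |D_K| = f^{p-1}$ the absolute value of its discriminant, $N = \omega(f)$ the number of distinct prime divisors of $f$ (i.e. the number of primes ramified in $K$), and $H = \#\mathcal{C}\ell_K$ its class number. Assume the following hypothesis: for every $\eta \in \,]0,1[$ there exist infinitely many $K \in \mathcal{K}_p^s$ such that $\#\mathcal{C}\ell_K \geq (\sqrt{|D_K|}\,)^{1-\eta}$. Let $\varepsilon \in \,]0,1[$. Order the fields of $\mathcal{K}_p^s$ by increasing conductors $f$ (equivalently increasing $D = f^{p-1}$) and consider $$C_\varepsilon(K) = \frac{H}{p^{N-1}\cdot (\sqrt{D}\,)^{\varepsilon}}, \qquad K \in \mathcal{K}_p^s.$$ Then the sequence of successive maxima of $C_\varepsilon(K)$ is infinite.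
   Context: For a sequence $(X_i)_{i\geq 1}$ of positive real numbers, its sequence of successive maxima $(Y_n)_{n\ge1}$ is defined inductively by $Y_1 = X_1$ and $Y_{n+1} = X_{i_{n+1}}$ where $i_{n+1}$ is the smallest index with $X_{i_{n+1}} > Y_n$ (if no such index exists the sequence stops); thus $Y_{n+1} > Y_n$ and the sequence of successive maxima may be finite or infinite. Here $X_i = C_\varepsilon(K_i)$ where $K_1, K_2, \dots$ enumerates $\mathcal{K}_p^s$ by increasing conductor. For real quadratic fields the class group $\mathcal{C}\ell_K$ is taken in the restricted (narrow) sense, so that $p^{N-1} = 2^{N-1}$ is the genus number; the quantity $H/p^{N-1}$ is the order of $\mathcal{C}\ell_K/\mathcal{C}\ell_K^{G} \simeq \mathcal{C}\ell_K^{1-\sigma}$, where $G = \mathrm{Gal}(K/\mathbb{Q}) = \langle \sigma\rangle$. *)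

(* Defs.v *)
From HB Require Import structures.
From mathcomp Require Import all_boot all_order all_algebra all_fingroup.
From mathcomp Require Import all_solvable all_field.
From mathcomp Require Import finmap boolp classical_sets cardinality reals exp.

Set Implicit Arguments.
Unset Strict Implicit.
Unset Printing Implicit Defensive.

Import Order.TTheory GRing.Theory Num.Theory.
Local Open Scope classical_set_scope.
Local Open Scope ring_scope.

(* An abstract Galois extension of rat stands for a Galois number field; such
   fields, taken up to ring isomorphism, are the Galois subfields of algC. *)
Notation numField := (splittingFieldType rat).

Definition isomorphic (K L : numField) : Prop :=
  exists f : {rmorphism K -> L}, bijective f.

Definition infinitely_many_fields (P : numField -> Prop) : Prop :=
  forall (n : nat) (L : 'I_n -> numField),
    exists K : numField, P K /\ forall i, ~ isomorphic K (L i).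

Section Invariants.
Variable K : numField.

Definition ring_of_integers : set K := [set x | integralOver (intr : int -> K) x].

Definition integral_basis (w : (\dim {:K}).-tuple K) : Prop :=
  basis_of {:K} w /\ forall x, ring_of_integers x <-> inIntSpan w x.

(* For a Galois extension, galTrace is the trace form Tr_{K/Q}. An integral
   basis exists and the determinant does not depend on it, so that the default
   value 0 is never taken. *)
Definition discriminant : int :=
  xget 0 [set d : int | exists w : (\dim {:K}).-tuple K, integral_basis w /\
    d%:~R = \det (\matrix_(i < \dim {:K}, j < \dim {:K})
                    galTrace 1 {:K} (w`_i * w`_j))].

Definition in_cyclotomic (f : nat) : Prop :=
  exists (phi : {rmorphism K -> algC}) (z : algC), f.-primitive_root z /\
    forall x, exists q : {poly rat}, phi x = (map_poly ratr q).[z].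

(* The conductor of an abelian field: the least f >= 1 such that K is contained
   in Q(mu_f). Such an f exists by the Kronecker-Weber theorem. *)
Definition conductor : nat :=
  xget 0%N [set f : nat | [/\ (0 < f)%N, in_cyclotomic f &
    forall g : nat, (0 < g)%N -> in_cyclotomic g -> (f <= g)%N]].

Definition is_real_field : Prop :=
  forall (phi : {rmorphism K -> algC}) (x : K), phi x \is Num.real.

(* Only used for real fields; the order of algC is such that 0 < z means that
   z is real and positive. *)
Definition totally_positive (x : K) : Prop :=
  forall phi : {rmorphism K -> algC}, 0 < phi x.

Definition fractional_ideal (I : set K) : Prop :=
  [/\ exists x, I x /\ x != 0,
      forall x y, I x -> I y -> I (x + y),
      forall a x, ring_of_integers a -> I x -> I (a * x) &
      exists d, [/\ ring_of_integers d, d != 0 &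
                    forall x, I x -> ring_of_integers (d * x)]].

(* Generators of the principal ideals that are quotiented out: the class group
   is the narrow one for real quadratic fields and the ordinary one otherwise. *)
Definition principal_generator (x : K) : Prop :=
  x != 0 /\ (\dim {:K} = 2%N -> is_real_field -> totally_positive x).

Definition ideal_equiv (I J : set K) : Prop :=
  exists x, principal_generator x /\ J = [set x * y | y in I].

Definition ideal_class (I : set K) : set (set K) :=
  [set J | fractional_ideal J /\ ideal_equiv I J].

Definition class_group : set (set (set K)) :=
  [set ideal_class I | I in [set I | fractional_ideal I]].

(* fset_set A is the finite set A, or the empty one if A is infinite; the class
   group of a number field is finite. *)
Definition class_number : nat := #|` fset_set class_group|.

End Invariants.

Definition omega (n : nat) : nat := size (primes n).

(* The signature s is true for +1 (real fields) and false for -1 (imaginary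
   fields); it only plays a role for p = 2. *)
Definition cyclic_family (p : nat) (s : bool) (K : numField) : Prop :=
  [/\ \dim {:K} = p,
      galois 1 {:K},
      cyclic 'Gal({:K} / 1) &
      p = 2%N -> if s then is_real_field K else ~ is_real_field K].

(* Fields with the same conductor may be listed in any order. *)
Definition enumerates_by_conductor (P : numField -> Prop) (K : nat -> numField)
    : Prop :=
  [/\ forall n, P (K n),
      forall L, P L -> exists n, isomorphic L (K n),
      forall m n, isomorphic (K m) (K n) -> m = n &
      forall m n, (m <= n)%N -> (conductor (K m) <= conductor (K n))%N].

Section Real.
Variable R : realType.

Definition sqrt_disc (K : numField) : R := Num.sqrt (`|discriminant K|%N%:R).

Definition C_eps (p : nat) (eps : R) (K : numField) : R :=
  (class_number K)%:R /
  ((p ^ (omega (conductor K) - 1))%:R * sqrt_disc K `^ eps).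

Definition next_index (X : nat -> R) (y : R) : option nat :=
  if pselect (exists i, y < X i) is left h then Some (ex_minn h) else None.

Fixpoint max_index (X : nat -> R) (n : nat) : option nat :=
  if n is m.+1 then obind (fun i => next_index X (X i)) (max_index X m)
  else Some 0%N.

(* Sequences are indexed from 0; None means that the sequence of successive
   maxima has stopped. *)
Definition successive_maxima (X : nat -> R) (n : nat) : option R :=
  omap X (max_index X n).

End Real.

(* Main.v *)
Require Import Defs.
From HB Require Import structures.
From mathcomp Require Import all_boot all_order all_algebra all_fingroup.
From mathcomp Require Import all_solvable all_field all_character.
From mathcomp Require Import finmap boolp classical_sets cardinality reals exp.
From mathcomp Require Import ring lra zify.

Set Implicit Arguments.
Unset Strict Implicit.
Unset Printing Implicit Defensive.

Import Order.TTheory GRing.Theory Num.Theory.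
Local Open Scope ring_scope.

(* It suffices that C_eps is unbounded on the family. Write D for the absolute
   discriminant and f for the conductor.

   A prime q <> p dividing f divides D: by minimality of f, some s in
   Gal(Q(mu_f)/Q(mu_{f/q})) acts non trivially on K, so that q divides f exactly
   once (otherwise s has order q, whereas Gal(K/Q) has order p), and then s acts
   trivially on integers modulo 1 - mu_q, which makes two rows of the matrix of
   conjugates of an integral basis congruent. Hence p^(N-1) <= p^omega(D), which
   is O(D^delta) for every delta > 0. If K were in no cyclotomic field, its
   conductor would be the default value 0, with omega(0) = 0; this is why the
   Kronecker-Weber theorem is not needed.

   With eta = (1 - eps) / 2, the fields given by the hypothesis thus satisfy
   C_eps >= c * D^kappa for some constants c, kappa > 0. By Hermite's theorem there
   are only finitely many fields with D <= d: reduction of the integral positive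
   definite form Tr (x * conj x), of determinant D, yields a generator of K with
   bounded conjugates. So D, and with it C_eps, is unbounded. *)

(** * Congruences between algebraic integers *)

Lemma dvdAP (e : algC) x :
  reflect (exists2 y, y \in Aint & x = e * y) (e %| x)%A.
Proof.
rewrite unfold_in; case: eqVneq => [-> | nz_e].
  apply: (iffP eqP) => [-> | [y _ ->]]; last by rewrite mul0r.
  by exists 0; rewrite ?rpred0 ?mulr0.
apply: (iffP idP) => [Axe | [y Ay ->]]; last by rewrite mulrAC divff ?mul1r.
by exists (x / e) => //; rewrite mulrC divfK.
Qed.

Lemma dvdA_trans (e d x : algC) : (e %| d -> d %| x -> e %| x)%A.
Proof.
move=> /dvdAP[a Aa ->] /dvdAP[b Ab ->]; apply/dvdAP.
by exists (a * b); rewrite ?rpredM ?mulrA.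
Qed.

Lemma dvdAX (e x : algC) n : (e %| x)%A -> (e ^+ n %| x ^+ n)%A.
Proof.
move=> /dvdAP[a Aa ->]; apply/dvdAP.
by exists (a ^+ n); rewrite ?rpredX ?exprMn.
Qed.

Lemma dvdA_mulr (e x y : algC) : y \in Aint -> (e %| x)%A -> (e %| x * y)%A.
Proof.
move=> Ay /dvdAP[a Aa ->]; apply/dvdAP.
by exists (a * y); rewrite ?rpredM ?mulrA.
Qed.

Lemma eqAmod_exp (e : algC) x y n : x \in Aint -> y \in Aint ->
  (x == y %[mod e])%A -> (x ^+ n == y ^+ n %[mod e])%A.
Proof.
move=> Ax Ay eq_xy; elim: n => [|n IHn]; first by rewrite !expr0.
by rewrite !exprS eqAmodM ?rpredX.
Qed.

Lemma eqAmod_exprD (q : nat) x y : prime q -> x \in Aint -> y \in Aint ->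
  ((x + y) ^+ q == x ^+ q + y ^+ q %[mod q])%A.
Proof.
move=> q_pr Ax Ay; case: q q_pr => // q q_pr.
rewrite exprDn big_ord_recl big_ord_recr /= /bump /= subn0 add1n subnn bin0 binn.
rewrite !expr0 mulr1 mul1r !mulr1n [(\sum_(i < q) _) + _]addrC addrA.
rewrite -[X in (_ == X %[mod _])%A]addr0 eqAmodDl eqAmod0 rpred_sum // => i _.
rewrite add1n.
have /dvdnP[k ->] : (q.+1 %| 'C(q.+1, i.+1))%N.
  by rewrite prime_dvd_bin //= ltnS ltn_ord.
apply/dvdAP; exists (x ^+ (q.+1 - i.+1) * y ^+ i.+1 *+ k).
  by rewrite rpredMn ?rpredM ?rpredX.
by rewrite mulr_natl -mulrnA.
Qed.

Lemma eqAmod_expr_sum (q : nat) (I : Type) (r : seq I) (F : I -> algC) :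
    prime q -> (forall i, F i \in Aint) ->
  ((\sum_(i <- r) F i) ^+ q == \sum_(i <- r) F i ^+ q %[mod q])%A.
Proof.
move=> q_pr AF; elim: r => [|i r IHr].
  by rewrite !big_nil expr0n /= -[q == 0%N]negbK -lt0n prime_gt0.
rewrite !big_cons; apply: eqAmod_trans (eqAmod_exprD q_pr _ _) _ => //.
  by rewrite rpred_sum.
exact: eqAmodD.
Qed.

Lemma eqAmod_intX (q : nat) (c : algC) : prime q -> c \in Num.int ->
  (c ^+ q == c %[mod q])%A.
Proof.
move=> q_pr /intrP[m ->].
have natX n : ((n%:R : algC) ^+ q == n%:R %[mod q])%A.
  by rewrite -natrX eqAmod_nat fermat_little.
case: m => n; first exact: natX.
rewrite NegzE mulrNz; set N := _%:~R.
have AN : N \in Aint by rewrite rpred_int.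
rewrite -(eqAmodDr q N) addNr -(@eqAmod_transl q ((- N) ^+ q + N ^+ q)).
  rewrite eqAmod_sym -[X in (X == _ %[mod _])%A](_ : (- N + N) ^+ q = _).
    by rewrite eqAmod_exprD ?rpredN.
  by rewrite addNr expr0n gtn_eqF ?prime_gt0.
by rewrite eqAmodDl natX.
Qed.

Lemma eqAmod_exprX_sum (q n k : nat) (c : nat -> algC) z : prime q ->
    (forall i, c i \in Num.int) -> z \in Aint ->
  ((\sum_(i < n) c i * z ^+ i) ^+ (q ^ k)
     == \sum_(i < n) c i * (z ^+ (q ^ k)) ^+ i %[mod q])%A.
Proof.
move=> q_pr Zc Az; have Ac i : c i \in Aint by apply: Aint_Cint.
elim: k => [|k IHk]; first by rewrite expn0 !expr1.
rewrite expnSr exprM.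
have AS y m : y \in Aint -> \sum_(i < m) c i * y ^+ i \in Aint.
  by move=> Ay; rewrite rpred_sum // => i _; rewrite rpredM ?rpredX.
have := eqAmod_exp q (rpredX _ (AS _ _ Az)) (AS _ _ (rpredX _ Az)) IHk.
move=> /eqAmod_trans; apply.
have AS' (i : 'I_n) : c i * (z ^+ (q ^ k)) ^+ i \in Aint.
  by rewrite rpredM ?rpredX.
have := eqAmod_expr_sum (index_enum 'I_n) q_pr (fun i => AS' i).
move=> /eqAmod_trans; apply.
rewrite /eqAmod -sumrB rpred_sum // => i _.
rewrite exprMn -!exprM [(q ^ k * i * q)%N]mulnAC.
by rewrite -/(eqAmod _ _ _) eqAmodMr ?rpredX ?eqAmod_intX.
Qed.

(* Frobenius is an automorphism of Z[z]/q, as q is prime to the order of z. *)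
Lemma dvdA_root_unity_expr (q n m : nat) (c : nat -> algC) z : prime q ->
    coprime q n -> n.-primitive_root z -> (forall i, c i \in Num.int) ->
    let v := \sum_(i < n) c i * z ^+ i in
  (q %| v ^+ m -> q %| v)%A.
Proof.
move=> q_pr co_q_n prz Zc v qvm.
have Az := Aint_prim_root prz; have n_gt0 := prim_order_gt0 prz.
have Ac i : c i \in Aint by apply: Aint_Cint.
have Av : v \in Aint.
  by rewrite rpred_sum // => i _; rewrite rpredM ?rpredX.
have := eqAmod_exprX_sum n (totient n * m) q_pr Zc Az; rewrite -/v.
have zq : z ^+ (q ^ (totient n * m)) = z.
  have /eqP : z ^+ (q ^ (totient n * m)) == z ^+ 1.
    rewrite (eq_prim_root_expr prz) expnM -modnXm Euler_exp_totient //.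
    by rewrite modnXm exp1n.
  by rewrite expr1.
rewrite zq -/v eqAmod_sym -eqAmod0 => /eqAmod_trans; apply.
have m_le : (m <= q ^ (totient n * m))%N.
  apply: leq_trans (ltnW (ltn_expl _ (prime_gt1 q_pr))) _.
  by rewrite leq_pexp2l ?prime_gt0 // leq_pmull ?totient_gt0.
by rewrite -(subnK m_le) exprD mulrC eqAmod0 dvdA_mulr ?rpredX.
Qed.

(** * Tame inertia in cyclotomic fields *)

Lemma sum_expr_root_unity (F : fieldType) n (t : F) :
  t ^+ n = 1 -> t != 1 -> \sum_(j < n) t ^+ j = 0.
Proof.
move=> tn1 t_neq1; apply/eqP; have := subrX1 t n.
by rewrite tn1 subrr => /esym/eqP; rewrite mulf_eq0 subr_eq0 (negPf t_neq1).
Qed.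

Lemma prim_root_neq0 (F : fieldType) n (w : F) : n.-primitive_root w -> w != 0.
Proof.
move=> prw; apply: contra_eq_neq (prim_expr_order prw) => ->.
by rewrite expr0n gtn_eqF ?(prim_order_gt0 prw) // eq_sym oner_eq0.
Qed.

Lemma gal_fix_gen (F : fieldType) (E : splittingFieldType F) (M : {subfield E})
    (w : E) (g : gal_of {:E}) : <<M; w>>%VS = fullv ->
  g \in 'Gal({:E} / M)%g -> g w = w -> g = 1%g.
Proof.
move=> genE gM gw; apply/eqP/gal_eqP => x _; rewrite gal_id.
have : x \in <<M; w>>%VS by rewrite genE memvf.
move=> /Fadjoin_polyP[p Mp ->]; rewrite -horner_map /= gw.
by rewrite (fixedPoly_gal (subvf M) gM).
Qed.

(* The inner sum over j of the j-th powers of w / g w vanishes unless g = 1. *)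
Lemma galTrace_root_unity (F : fieldType) (E : splittingFieldType F)
    (M : {subfield E}) n (w y : E) :
    n.-primitive_root w -> <<M; w>>%VS = fullv ->
  y *+ n = \sum_(j < n) galTrace M {:E} (y * w ^- j) * w ^+ j.
Proof.
move=> prw genE; under eq_bigr => j _ do rewrite mulr_suml.
have w_neq0 := prim_root_neq0 prw.
rewrite exchange_big (bigD1 1%g) ?group1 //= [X in _ + X]big1 ?addr0 => [|g /andP[gM gN1]].
  rewrite -[n in LHS]card_ord -sumr_const; apply: eq_bigr => j _.
  by rewrite gal_id mulfVK // expf_neq0.
under eq_bigr => j _ do
  rewrite rmorphM fmorphV rmorphXn /= -mulrA [_^-1 * _]mulrC -expr_div_n.
rewrite -mulr_sumr sum_expr_root_unity ?mulr0 //.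
  by rewrite expr_div_n -rmorphXn (prim_expr_order prw) rmorph1 divr1.
apply: contraNneq gN1 => w_gw; apply/eqP/(gal_fix_gen genE gM)/esym.
by rewrite -[RHS]mul1r -w_gw divfK // fmorph_eq0.
Qed.

Lemma gal_Aint (E : splittingFieldType rat) (iota : {rmorphism E -> algC})
  (g : gal_of {:E}) y : (iota (g y) \in Aint) = (iota y \in Aint).
Proof. by have [nu ->] := extend_algC_subfield_aut iota g; rewrite Aint_aut. Qed.

Lemma galTrace_Aint (E : splittingFieldType rat) (iota : {rmorphism E -> algC})
    (M : {subfield E}) y : iota y \in Aint ->
  iota (galTrace M {:E} y) \in Aint.
Proof.
by move=> Ay; rewrite rmorph_sum rpred_sum // => g _; rewrite gal_Aint.
Qed.

Lemma separable_rat (E : fieldExtType rat) (M : {subfield E}) : separable M {:E}.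
Proof.
apply/separableP => x _; apply: pcharf0_separable => i.
by rewrite pchar_lalg pchar_num.
Qed.

Lemma galois_rat (E : splittingFieldType rat) (M : {subfield E}) : galois M {:E}.
Proof.
apply/and3P; split; [exact: subvf | exact: separable_rat | exact: normalFieldf].
Qed.

Lemma galTrace_int (E : splittingFieldType rat) (iota : {rmorphism E -> algC}) y :
  iota y \in Aint -> iota (galTrace 1 {:E} y) \in Num.int.
Proof.
move=> Ay; have : galTrace 1 {:E} y \in 1%VS.
  by rewrite (mem_galTrace (galois_rat 1%AS)) ?memvf.
move=> tr1; apply: Cint_rat_Aint; last exact: (galTrace_Aint 1%AS).
by have /vlineP[a ->] := tr1; rewrite alg_num_field fmorph_rat Crat_rat.
Qed.

Lemma fAdjoin1_poly (E : fieldExtType rat) (w y : E) (iota : {rmorphism E -> algC}) :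
  y \in <<1; w>>%VS -> exists h : {poly rat}, iota y = (map_poly ratr h).[iota w].
Proof.
move=> /Fadjoin_polyP[p /polyOver1P[h ->] ->]; exists h.
rewrite -horner_map -map_poly_comp; congr _.[_].
by apply: eq_map_poly => a /=; rewrite alg_num_field fmorph_rat.
Qed.

Lemma cyclotomic_field_exists n (z : algC) : n.-primitive_root z ->
  exists (E : splittingFieldType rat) (iota : {rmorphism E -> algC}) (w : E),
    [/\ iota w = z, n.-primitive_root w & <<1; w>>%VS = fullv].
Proof.
move=> prz; have n_gt0 := prim_order_gt0 prz.
case: n prz n_gt0 => // n prz _.
have [E _ [iota _ [w0 []]]] := group_num_field_exists [set: 'I_n.+1]%G.
rewrite cardsT card_ord => prw0 gen_w0 _.
have [i Dz] : exists i, z = iota (w0 ^+ i).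
  have priw0 : n.+1.-primitive_root (iota w0) by rewrite fmorph_primitive_root.
  have [i ->] := prim_rootP priw0 (prim_expr_order prz).
  by exists i; rewrite rmorphXn.
have prw : n.+1.-primitive_root (w0 ^+ i).
  by rewrite -(fmorph_primitive_root iota) -Dz.
exists E, iota, (w0 ^+ i); split=> //.
apply/eqP; rewrite eqEsubv subvf -gen_w0 /=; apply/FadjoinP; rewrite sub1v.
have [j Dw0] := prim_rootP prw (prim_expr_order prw0).
by split=> //; rewrite {1}Dw0 rpredX // memv_adjoin.
Qed.

Lemma Aint_cyclotomic_expansion n (z u : algC) (h : {poly rat}) :
    n.-primitive_root z -> u \in Aint -> u = (map_poly ratr h).[z] ->
  exists2 c : nat -> algC, forall i, c i \in Num.int
    & u *+ n = \sum_(i < n) c i * z ^+ i.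
Proof.
move=> prz Au Du; have [E [iota [w [Dz prw genE]]]] := cyclotomic_field_exists prz.
pose y := (map_poly (in_alg E) h).[w].
have Dy : iota y = u.
  rewrite Du -Dz -horner_map -map_poly_comp; congr _.[_].
  by apply: eq_map_poly => a /=; rewrite alg_num_field fmorph_rat.
exists (fun i => iota (galTrace 1 {:E} (y * w ^- i))) => [i|]; last first.
  rewrite -Dy -rmorphMn (galTrace_root_unity y prw genE) rmorph_sum.
  by apply: eq_bigr => i _; rewrite rmorphM rmorphXn Dz.
apply: galTrace_int; rewrite rmorphM fmorphV rmorphXn Dz Dy rpredM //.
apply: (@Aint_unity_root n); rewrite ?(prim_order_gt0 prz) //.
apply/unity_rootP; rewrite exprVn exprAC (prim_expr_order prz) expr1n invr1 //.
Qed.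

(* In other words, q is unramified in Q(z). *)
Lemma dvdA_cyclotomic_expr (q n m : nat) (z u : algC) (h : {poly rat}) :
    prime q -> coprime q n -> n.-primitive_root z ->
    u \in Aint -> u = (map_poly ratr h).[z] ->
  (q %| u ^+ m -> q %| u)%A.
Proof.
move=> q_pr co_q_n prz Au Du q_um.
have [c Zc Dnu] := Aint_cyclotomic_expansion prz Au Du.
have : (q %| u *+ n)%A.
  rewrite Dnu; apply: (@dvdA_root_unity_expr q n m) => //.
  by rewrite -Dnu -mulr_natr exprMn dvdA_mulr // rpredX // rpred_nat.
move=> /dvdAP[a Aa una].
have [s _ /dvdnP[r Er]] := Bezoutl n (prime_gt0 q_pr).
rewrite (eqP co_q_n) in Er.
apply/dvdAP; exists (u *+ r - a *+ s); first by rewrite rpredB ?rpredMn.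
have Du' : u = u *+ (r * q) - u *+ n *+ s.
  by rewrite -Er mulrnDr mulr1n -mulrnA [(n * s)%N]mulnC addrK.
by rewrite {1}Du' una mulrBr !mulr_natl -!mulrnA [(s * q)%N]mulnC.
Qed.

Lemma dvdA_prim_root_pow (q : nat) (w : algC) : prime q -> w ^+ q = 1 ->
  w \in Aint -> (q %| (1 - w) ^+ q)%A.
Proof.
move=> q_pr wq1 Aw.
have := eqAmod_exprD q_pr (rpred1 Aint) (_ : - w \in Aint).
rewrite rpredN => /(_ Aw) /eqAmod_trans => eqq.
rewrite -eqAmod0; apply: eqq; have := eqAmod_exprD q_pr Aw (_ : - w \in Aint).
rewrite rpredN => /(_ Aw); rewrite subrr expr0n gtn_eqF ?prime_gt0 //=.
by rewrite wq1 expr1n eqAmod_sym.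
Qed.

Lemma dvdA_1_sub_exp (w : algC) j : w \in Aint -> (1 - w %| 1 - w ^+ j)%A.
Proof.
move=> Aw; apply/dvdAP; exists (\sum_(i < j) w ^+ i).
  by rewrite rpred_sum // => i _; rewrite rpredX.
by rewrite -{1}(expr1n _ j) subrXX; congr (_ * _); apply: eq_bigr => i _;
   rewrite expr1n mul1r.
Qed.

Section TameInertia.

Variables (E : splittingFieldType rat) (iota : {rmorphism E -> algC}).
Variables (q n : nat) (w z : E).
Hypotheses (q_pr : prime q) (co_q_n : coprime q n).
Hypotheses (prw : q.-primitive_root w) (prz : n.-primitive_root z).
Let M : {subfield E} := <<1; z>>%AS.
Hypothesis genE : <<M; w>>%VS = fullv.
Let pi := 1 - iota w.

Let Aw : iota w \in Aint.
Proof. by apply: (@Aint_prim_root q); rewrite fmorph_primitive_root. Qed.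

Let dvdA_pi_unity (t : E) : t ^+ q = 1 -> (pi %| 1 - iota t)%A.
Proof. by move=> /(prim_rootP prw)[i ->]; rewrite rmorphXn dvdA_1_sub_exp. Qed.

Let dvdA_pi_M u : u \in M -> iota u \in Aint -> (pi %| iota u)%A ->
  (q %| iota u)%A.
Proof.
move=> Mu Au pi_u; have [h Dh] := fAdjoin1_poly iota Mu.
apply: (dvdA_cyclotomic_expr (m := q) q_pr co_q_n _ Au Dh).
  by rewrite fmorph_primitive_root.
apply: dvdA_trans (dvdAX q pi_u); apply: dvdA_prim_root_pow => //.
by rewrite -rmorphXn (prim_expr_order prw) rmorph1.
Qed.

(* Expand y over the powers of w; the coefficients can be taken in M and
   integral because q is unramified in M. *)
Lemma tame_inertia_congr (s : gal_of {:E}) y :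
    s \in 'Gal({:E} / M)%g -> iota y \in Aint ->
  (1 - iota w %| iota (s y) - iota y)%A.
Proof.
move=> sM Ay; rewrite -/pi.
have w_neq0 := prim_root_neq0 prw.
pose t j := galTrace M {:E} (y * w ^- j); pose u j := t j - t 0%N.
have Mt j : t j \in M by rewrite (mem_galTrace (galois_rat M)) ?memvf.
have Mu j : u j \in M by rewrite rpredB.
have AwV j : iota (w ^- j) \in Aint.
  apply: (@Aint_unity_root q); rewrite ?prime_gt0 //.
  apply/unity_rootP; rewrite -rmorphXn exprVn exprAC (prim_expr_order prw).
  by rewrite expr1n invr1 rmorph1.
have At j : iota (t j) \in Aint by rewrite galTrace_Aint // rmorphM rpredM.
have pi_u j : (pi %| iota (u j))%A.
  rewrite /u /t -raddfB -mulrBr expr0 invr1 rmorph_sum rpred_sum // => g _.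
  rewrite !rmorphM mulrC dvdA_mulr ?gal_Aint // rmorphB rmorph1 -opprB rmorphN.
  rewrite rpredN /= rmorphB rmorph1 dvdA_pi_unity // -rmorphXn exprVn exprAC.
  by rewrite (prim_expr_order prw) expr1n invr1 rmorph1.
have q_u j : (q %| iota (u j))%A by rewrite dvdA_pi_M // rmorphB rpredB.
have q_neq0 : (q%:R : E) != 0.
  by rewrite -(fmorph_eq0 iota) rmorph_nat pnatr_eq0 -lt0n prime_gt0.
pose v j := u j / q%:R.
have Mv j : v j \in M by rewrite rpred_div ?rpred_nat.
have Av j : iota (v j) \in Aint.
  have /dvdAP[a Aa Da] := q_u j.
  rewrite fmorph_div rmorph_nat Da mulrC mulrA mulVf ?mul1r //.
  by rewrite pnatr_eq0 -lt0n prime_gt0.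
have Dy : y = \sum_(j < q) v j * w ^+ j.
  apply: (mulIf q_neq0); rewrite mulr_natr (galTrace_root_unity y prw genE).
  have sumw : \sum_(j < q) w ^+ j = 0.
    rewrite sum_expr_root_unity ?(prim_expr_order prw) //.
    rewrite -[w]expr1 -(expr0 w) (eq_prim_root_expr prw).
    by rewrite mod0n modn_small ?prime_gt1.
  rewrite mulr_suml -[LHS]subr0.
  transitivity (\sum_(j < q) t j * w ^+ j - t 0%N * \sum_(j < q) w ^+ j).
    by rewrite sumw mulr0.
  rewrite mulr_sumr -sumrB; apply: eq_bigr => j _.
  by rewrite -mulrBl -/(t j) -/(u j) mulrAC divfK.
rewrite Dy -rmorphB /= rmorph_sum -sumrB rmorph_sum rpred_sum // => j _.
rewrite rmorphM /= (fixed_gal (subvf M) sM (Mv j)) -mulrBr rmorphM mulrC.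
rewrite dvdA_mulr // rmorphXn.
have -> : s w ^+ j - w ^+ j = - w ^+ j * (1 - (s w / w) ^+ j).
  by rewrite mulrBr mulr1 expr_div_n mulNr mulrC divfK ?expf_neq0 // opprK addrC.
rewrite rmorphM mulrC dvdA_mulr //.
  by rewrite rmorphN rpredN rmorphXn rpredX.
rewrite rmorphB rmorph1 dvdA_pi_unity // exprAC expr_div_n -rmorphXn.
by rewrite (prim_expr_order prw) rmorph1 divr1 expr1n.
Qed.

End TameInertia.

(** * Integral bases and the discriminant *)

Lemma num_field_morph (K : fieldExtType rat) (F : fieldType)
    (j : {rmorphism rat -> F}) (a : K) (b : F) :
    <<1; a>>%VS = fullv ->
    (forall h, (map_poly (in_alg K) h).[a] = 0 -> (map_poly j h).[b] = 0) ->
  exists f : {rmorphism K -> F}, f a = b.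
Proof.
move=> genK ab.
have polyK x : exists h : {poly rat}, x = (map_poly (in_alg K) h).[a].
  have : x \in <<1; a>>%VS by rewrite genK memvf.
  by move=> /Fadjoin_polyP[p /polyOver1P[h ->] ->]; exists h.
pose P x := projT1 (cid (polyK x)).
have PE x : x = (map_poly (in_alg K) (P x)).[a] by rewrite /P; case: cid.
pose f x := (map_poly j (P x)).[b].
have fE h : f (map_poly (in_alg K) h).[a] = (map_poly j h).[b].
  apply/eqP; rewrite -subr_eq0 -hornerN -hornerD -rmorphB ab ?rmorphB //=.
  by rewrite hornerD hornerN -PE subrr.
have fB : zmod_morphism f.
  move=> x y; rewrite {1}(PE x) {1}(PE y) -hornerN -hornerD -rmorphB /= fE.
  by rewrite rmorphB hornerD hornerN.
have fM : monoid_morphism f.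
  split=> [|x y]; last first.
    by rewrite {1}(PE x) {1}(PE y) -hornerM -rmorphM /= fE rmorphM hornerM.
  by have := fE 1; rewrite !rmorph1 -!polyC1 !hornerC.
pose fA := GRing.isZmodMorphism.Build K F f fB.
pose fMM := GRing.isMonoidMorphism.Build K F f fM.
pose g : {rmorphism K -> F} := HB.pack f fA fMM.
exists g; rewrite /= -[in LHS](hornerX a) -(map_polyX (in_alg K)) fE.
by rewrite map_polyX hornerX.
Qed.

Lemma algC_embedding (K : fieldExtType rat) : exists phi : {rmorphism K -> algC}, True.
Proof.
have genK := eq_adjoin_separable_generator (separable_rat 1%AS) (sub1v {:K}).
set a := separable_generator _ _ in genK.
have /polyOver1P[P DP] := minPolyOver 1 a.
have /closed_rootP[b Pb] : size (map_poly (ratr : rat -> algC) P) != 1%N.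
  by rewrite size_map_poly -(size_map_poly (in_alg K)) -DP size_minPoly.
have [h ha|f _] := @num_field_morph K algC ratr a b (esym genK); last by exists f.
have /dvdpP[r Dr]: P %| h.
  rewrite -(dvdp_map (in_alg K)) -DP minPoly_dvdp //; last exact/rootP.
  by apply/polyOver1P; exists h.
by rewrite Dr rmorphM hornerM (rootP Pb) mulr0.
Qed.

Lemma ring_of_integersP (K : numField) (phi : {rmorphism K -> algC}) x :
  ring_of_integers x <-> phi x \in Aint.
Proof.
split=> [[p mon_p px] | Ax].
  apply: (@root_monic_Aint (map_poly intr p)).
  - have := rmorph_root phi px; rewrite -map_poly_comp /=.
    by rewrite (@eq_map_poly _ _ _ intr) // => i /=; rewrite rmorph_int.
  - exact: monic_map.
  - by apply/polyOverP => i; rewrite coef_map /= intr_int.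
have /floorpP[p Dp] : minCpoly (phi x) \is a polyOver Num.int by [].
exists p.
  have := minCpoly_monic (phi x); rewrite Dp !monicE lead_coef_map_inj //.
    by rewrite -[1]/(1%:~R) (inj_eq (@intr_inj _)).
  exact: intr_inj.
have := root_minCpoly (phi x); rewrite Dp -(fmorph_root phi) -map_poly_comp.
by rewrite (@eq_map_poly _ _ (phi \o _) intr) // => i /=; rewrite rmorph_int.
Qed.

Lemma intr_num_field_eq0 (K : fieldExtType rat) (m : int) :
  (m%:~R == 0 :> K) = (m == 0).
Proof. by rewrite -(rmorph_int (in_alg K)) fmorph_eq0 intr_eq0. Qed.

(* If N is the leading coefficient of an integral polynomial of degree m
   vanishing at x, then N^(m-1) times the polynomial is monic in N x. *)
Lemma integral_multiple (K : numField) (x : K) :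
  exists2 N : int, N != 0 & ring_of_integers (N%:~R * x).
Proof.
have /polyOver1P[P DP] := minPolyOver 1%AS x.
have P_neq0 : P != 0.
  by rewrite -(map_poly_eq0 (in_alg K)) -DP monic_neq0 ?monic_minPoly.
have [q [a a_neq0 Dq]] := rat_poly_scale P.
have q_neq0 : q != 0.
  by apply: contraNneq P_neq0 => q0; rewrite Dq q0 rmorph0 scaler0.
have qx : (map_poly (intr : int -> K) q).[x] = 0.
  have /rootP := root_minPoly 1%AS x; rewrite DP Dq map_polyZ hornerZ.
  move/eqP; rewrite mulf_eq0 fmorph_eq0 invr_eq0 intr_eq0 (negPf a_neq0) /=.
  rewrite -map_poly_comp (@eq_map_poly _ _ (in_alg K \o _) intr) => [/eqP//|i /=].
  by rewrite alg_num_field ratr_int.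
pose m := (size q).-1; pose N := lead_coef q.
have Sq : size q = m.+1 by rewrite prednK // size_poly_gt0.
have qxE : (map_poly (intr : int -> K) q).[x] =
    \sum_(i < m) (q`_i)%:~R * x ^+ i + N%:~R * x ^+ m.
  rewrite (@horner_coef_wide _ m.+1); last by rewrite -Sq size_poly.
  by rewrite big_ord_recr /= !coef_map; under eq_bigr do rewrite coef_map.
have m_gt0 : (0 < m)%N.
  rewrite lt0n; apply: contra_eq_neq qx => m0.
  rewrite qxE {}m0 big_ord0 add0r expr0 mulr1 intr_num_field_eq0.
  by rewrite lead_coef_eq0.
pose r := \poly_(i < m) (q`_i * N ^+ (m.-1 - i)).
have size_r : (size r < size ('X^m : {poly int}))%N.
  by rewrite size_polyXn ltnS size_poly.
exists N; first by rewrite lead_coef_eq0.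
exists ('X^m + r).
  by rewrite monicE lead_coefDl // lead_coefXn.
apply/rootP; rewrite rmorphD /= map_polyXn hornerD hornerXn.
rewrite (@horner_coef_wide _ m (map_poly _ r)); last first.
  by rewrite (leq_trans (size_poly _ _)) // size_poly.
transitivity (N%:~R ^+ m.-1 * (map_poly (intr : int -> K) q).[x]); last first.
  by rewrite qx mulr0.
rewrite qxE mulrDr addrC mulr_sumr; congr (_ + _).
  apply: eq_bigr => i _; rewrite coef_map coef_poly ltn_ord /= intrM (rmorphXn intr) /=.
  rewrite exprMn -[in RHS](@subnK i m.-1); first by rewrite exprD; ring.
  by rewrite -ltnS prednK.
by rewrite mulrA -exprSr prednK // exprMn.
Qed.

Lemma gal_enum (K : numField) :
  exists e : 'I_(\dim {:K}) -> gal_of {:K},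
    [/\ forall i, e i \in 'Gal({:K} / 1)%g, injective e,
        forall g, g \in 'Gal({:K} / 1)%g -> exists i, g = e i &
        forall (R : nmodType) (F : gal_of {:K} -> R),
          \sum_(g in 'Gal({:K} / 1)%g) F g = \sum_i F (e i)].
Proof.
have := galois_dim (galois_rat (1%AS : {subfield K})); rewrite dimv1 divn1 => ->.
exists (fun i => enum_val i); split=> [i|||R F].
- exact: enum_valP.
- exact: enum_val_inj.
- by move=> g gG; exists (enum_rank_in gG g); rewrite enum_rankK_in.
- exact: big_enum_val.
Qed.

Lemma det_replace_row (R : comNzRingType) n (A B : 'M[R]_n) (i0 : 'I_n)
    (b : 'I_n -> R) :
    (forall i, i != i0 -> row i B = row i A) ->
    row i0 B = \sum_k b k *: row k A ->
  \det B = b i0 * \det A.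
Proof.
move=> eqBA Bi0; rewrite (expand_det_row B i0).
have cofE j : cofactor B i0 j = cofactor A i0 j.
  congr (_ * \det _); apply/matrixP => i k; rewrite !mxE.
  have lift_neq : lift i0 i != i0 by rewrite eq_sym neq_lift.
  by have /rowP/(_ (lift j k)) := eqBA _ lift_neq; rewrite !mxE.
under eq_bigr => j _ do rewrite cofE.
have BE j : B i0 j = \sum_k b k * A k j.
  have /rowP/(_ j) := Bi0; rewrite mxE summxE => ->.
  by apply: eq_bigr => k _; rewrite !mxE.
under eq_bigr => j _ do rewrite BE mulr_suml.
rewrite exchange_big /=.
have adjE k : \sum_j A k j * cofactor A i0 j = (k == i0)%:R * \det A.
  have /matrixP/(_ k i0) := mul_mx_adj A; rewrite !mxE mulr_natl => <-.
  by apply: eq_bigr => j _; rewrite !mxE.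
under eq_bigr => k _.
  under eq_bigr => j _ do rewrite -mulrA.
  rewrite -mulr_sumr adjE; over.
rewrite (bigD1 i0) //= eqxx mul1r big1 ?addr0 // => k /negPf->.
by rewrite mul0r mulr0.
Qed.

Section Discriminant.

Variables (K : numField) (e : 'I_(\dim {:K}) -> gal_of {:K}).
Let n := \dim {:K}.
Hypothesis e_gal : forall i, e i \in 'Gal({:K} / 1)%g.
Hypothesis e_inj : injective e.
Hypothesis e_surj : forall g, g \in 'Gal({:K} / 1)%g -> exists i, g = e i.
Hypothesis e_sum : forall (R : nmodType) (F : gal_of {:K} -> R),
  \sum_(g in 'Gal({:K} / 1)%g) F g = \sum_i F (e i).

Definition conj_mx (w : 'I_n -> K) : 'M[K]_n := \matrix_(j, i) e i (w j).

Lemma trace_mxE (w : 'I_n -> K) :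
  \matrix_(i, j) galTrace 1 {:K} (w i * w j) = conj_mx w *m (conj_mx w)^T.
Proof.
apply/matrixP => i j; rewrite !mxE /galTrace e_sum; apply: eq_bigr => k _.
by rewrite !mxE rmorphM.
Qed.

Lemma det_trace_mx (w : 'I_n -> K) :
  \det (\matrix_(i, j) galTrace 1 {:K} (w i * w j)) = \det (conj_mx w) ^+ 2.
Proof. by rewrite trace_mxE det_mulmx det_tr expr2. Qed.

Lemma basis_conj_mx (w : n.-tuple K) :
  basis_of {:K} w <-> \det (conj_mx (fun i => w`_i)) != 0.
Proof.
split=> [/andP[/eqP span_w _] | det_neq0]; last first.
  rewrite basisEfree subvf size_tuple leqnn !andbT; apply/freeP => c c0 i.
  pose W := conj_mx (fun i => w`_i).
  have : (\row_j (c j)%:A) *m W = 0.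
    apply/rowP => k; rewrite !mxE.
    transitivity (e k (\sum_(j < n) c j *: w`_j)); last by rewrite c0 rmorph0.
    rewrite rmorph_sum /=.
    by apply: eq_bigr => j _; rewrite !mxE linearZ mulr_algl.
  have Wu : W \in unitmx by rewrite unitmxE unitfE.
  move/(congr1 (mulmx^~ (invmx W))); rewrite mulmxK // mul0mx.
  move/rowP/(_ i); rewrite !mxE => /eqP.
  by rewrite scaler_eq0 oner_eq0 orbF => /eqP.
rewrite -det_tr; apply/negP => /det0P[v /eqP v_neq0 /rowP vW]; apply: v_neq0.
have c_e k : \sum_i v 0 i *+ (e i == e k) = v 0 k.
  rewrite (bigD1 k) //= eqxx big1 ?addr0 // => i /negPf.
  by rewrite (inj_eq e_inj) => ->.
apply/rowP => k; rewrite mxE -c_e.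
pose c g := \sum_i v 0 i *+ (e i == g).
apply: (@gal_independent _ _ _ (mem 'Gal({:K} / 1)%g) c) (e_gal k) => a _.
rewrite e_sum; have /coord_span-> : a \in <<w>>%VS by rewrite span_w memvf.
under eq_bigr => i _ do rewrite /c c_e rmorph_sum mulr_sumr.
rewrite exchange_big big1 // => j _; have := vW j; rewrite !mxE => vWj.
under eq_bigr => i _ do rewrite /= linearZ -scalerAr.
rewrite -scaler_sumr -[X in _ *: X](_ : \sum_i v 0 i * (conj_mx (fun i => w`_i))^T i j = _).
  by rewrite vWj scaler0.
by apply: eq_bigr => i _; rewrite !mxE.
Qed.

Lemma discriminant_int (w : 'I_n -> K) :
    (forall i, ring_of_integers (w i)) ->
  exists d : int, d%:~R = \det (conj_mx w) ^+ 2.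
Proof.
move=> Zw; rewrite -det_trace_mx.
have [phi _] := algC_embedding K.
have Zt i j : exists m : int, m%:~R = galTrace 1 {:K} (w i * w j).
  have /intrP[m Dm] : phi (galTrace 1 {:K} (w i * w j)) \in Num.int.
    by apply: galTrace_int; rewrite rmorphM rpredM //; apply/ring_of_integersP.
  by exists m; apply: (fmorph_inj phi); rewrite rmorph_int.
pose T := \matrix_(i, j) projT1 (cid (Zt i j)).
exists (\det T); rewrite -det_map_mx; congr (\det _).
by apply/matrixP => i j; rewrite !mxE; case: cid.
Qed.

End Discriminant.

Lemma ring_of_integers_int_sum (K : numField) n (w : 'I_n -> K) (c : 'I_n -> int) :
  (forall i, ring_of_integers (w i)) -> ring_of_integers (\sum_i w i *~ c i).
Proof.
have [phi _] := algC_embedding K; move=> Zw.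
apply/(ring_of_integersP phi); rewrite rmorph_sum rpred_sum // => i _.
by rewrite rmorphMz rpredMz //; apply/ring_of_integersP.
Qed.

(* A basis of K made of integers, with discriminant minimal in absolute value,
   is an integral basis: a fractional coordinate t of an integer would allow
   a replacement multiplying the discriminant by t^2. *)
Lemma integral_basis_exists (K : numField) :
  exists w : (\dim {:K}).-tuple K, integral_basis w.
Proof.
have [e [e_gal e_inj e_surj e_sum]] := gal_enum K.
have [phi _] := algC_embedding K; set n := \dim {:K} in e e_gal e_inj e_surj e_sum *.
have basisP := basis_conj_mx e_gal e_inj e_sum.
have discP := discriminant_int e_sum.
pose cand (w : n.-tuple K) := basis_of {:K} w /\ forall i : 'I_n, ring_of_integers w`_i.
pose disc (w : n.-tuple K) (d : int) :=
  d%:~R = \det (conj_mx e (fun i => w`_i)) ^+ 2.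
have [w0 cand_w0] : exists w, cand w.
  pose v := vbasis {:K}.
  have Nv (i : 'I_n) : exists N : int, N != 0 /\ ring_of_integers (N%:~R * v`_i).
    by have [N] := integral_multiple v`_i; exists N.
  pose N i := projT1 (cid (Nv i)).
  have NP i : N i != 0 /\ ring_of_integers ((N i)%:~R * v`_i).
    by rewrite /N; case: cid.
  exists [tuple (N i)%:~R * v`_i | i < n]; split=> [|i]; last first.
    by rewrite -tnth_nth tnth_mktuple; case: (NP i).
  apply/basisP.
  have -> : conj_mx e (fun i => [tuple (N i)%:~R * v`_i | i < n]`_i) =
            diag_mx (\row_i (N i)%:~R) *m conj_mx e (fun i => v`_i).
    apply/matrixP => i j; rewrite mul_diag_mx !mxE -tnth_nth tnth_mktuple.
    by rewrite rmorphM rmorph_int.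
  rewrite det_mulmx det_diag mulf_neq0 //; last exact/basisP/vbasisP.
  apply/prodf_neq0 => i _; rewrite mxE intr_num_field_eq0; by case: (NP i).
pose P k := `[< exists w d, [/\ cand w, disc w d & `|d|%N = k] >].
have exP : exists k, P k.
  have [d Dd] := discP _ cand_w0.2.
  by exists `|d|%N; apply/asboolP; exists w0, d.
case: (ex_minnP exP) => d_min /asboolP[w [d [[w_basis Zw] Dd Dd_min]]] min_d.
exists w; split=> // x; split=> [Zx | [c ->]]; last exact: ring_of_integers_int_sum.
suffices Za i : coord w i x \is a Num.int.
  exists [ffun i => Num.floor (coord w i x)].
  rewrite {1}(coord_basis w_basis (memvf x)); apply: eq_bigr => i _.
  by rewrite ffunE -scaler_int floorK.
apply/negPn/negP => Na; set a := coord w i x in Na.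
pose m := Num.floor a; pose t := a - m%:~R.
have t_gt0 : 0 < t.
  rewrite lt_neqAle subr_ge0 floor_le andbT eq_sym subr_eq0.
  by apply: contra Na => /eqP->; apply: intr_int.
have t_lt1 : t < 1 by rewrite ltrBlDl; have := floorD1_gt a; rewrite intrD.
pose x' := x - m%:~R * w`_i.
pose w' := [tuple if j == i then x' else w`_j | j < n].
have w'E (j : 'I_n) : w'`_j = if j == i then x' else w`_j.
  by rewrite -tnth_nth tnth_mktuple.
have Zx' : ring_of_integers x'.
  apply/(ring_of_integersP phi); rewrite rmorphB rmorphM rmorph_int rpredB //.
    exact/ring_of_integersP.
  by rewrite rpredM ?rpred_int //; apply/ring_of_integersP.
have det_w' : \det (conj_mx e (fun i => w'`_i)) =
               t%:A * \det (conj_mx e (fun i => w`_i)).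
  pose b k := (coord w k x - m%:~R * (k == i)%:R)%:A : K.
  rewrite (@det_replace_row _ _ (conj_mx e (fun i => w`_i)) _ i b) => [|j /negPf ji|].
  - by rewrite /b eqxx mulr1.
  - by apply/rowP => k; rewrite !mxE w'E ji.
  apply/rowP => k; rewrite !mxE w'E eqxx summxE /x'.
  rewrite {1}(coord_basis w_basis (memvf x)).
  have -> : m%:~R * w`_i = \sum_(j < n) (m%:~R * (j == i)%:R) *: w`_j.
    rewrite (bigD1 i) //= eqxx mulr1 big1 ?addr0 => [|j /negPf->].
      by rewrite scaler_int mulrzl.
    by rewrite mulr0 scale0r.
  rewrite -sumrB rmorph_sum; apply: eq_bigr => j _ /=.
  by rewrite !mxE -scalerBl linearZ mulr_algl.
have det_neq0 := (basisP w).1 w_basis.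
have cand_w' : cand w'.
  split=> [|j]; last by rewrite w'E; case: eqP.
  by apply/basisP; rewrite det_w' mulf_neq0 // scaler_eq0 oner_eq0 gt_eqF.
have [d' Dd'] := discP _ cand_w'.2.
have d'E : d'%:~R = t ^+ 2 * d%:~R :> rat.
  apply: (fmorph_inj (in_alg K)); rewrite rmorphM rmorphXn !rmorph_int.
  by rewrite Dd' Dd det_w' exprMn.
have d_neq0 : d != 0.
  by rewrite -(intr_num_field_eq0 K) Dd expf_neq0.
have : (d_min <= `|d'|)%N by apply: min_d; apply/asboolP; exists w', d'.
rewrite -Dd_min leqNgt -ltz_nat -(ltr_int rat) !abszE !intr_norm d'E normrM.
rewrite gtr_pMl ?normr_gt0 ?intr_eq0 // normrX gtr0_norm //.
by rewrite expr_lt1 ?t_lt1 // ltW.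
Qed.

Lemma integral_basis_mem (K : numField) (w : (\dim {:K}).-tuple K) i :
  integral_basis w -> (i < \dim {:K})%N -> ring_of_integers w`_i.
Proof.
move=> [_ ibw] lt_i; apply/ibw; exists [ffun j => (j == Ordinal lt_i)%:R].
rewrite (bigD1 (Ordinal lt_i)) //= ffunE eqxx mulr1z big1 ?addr0 // => j /negPf ji.
by rewrite ffunE ji mulr0z.
Qed.

Lemma discriminantP (K : numField) (e : 'I_(\dim {:K}) -> gal_of {:K}) :
    (forall i, e i \in 'Gal({:K} / 1)%g) -> injective e ->
    (forall (R : nmodType) (F : gal_of {:K} -> R),
      \sum_(g in 'Gal({:K} / 1)%g) F g = \sum_i F (e i)) ->
  discriminant K != 0 /\
  exists w : (\dim {:K}).-tuple K, integral_basis w /\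
    (discriminant K)%:~R = \det (conj_mx e (fun i => w`_i)) ^+ 2.
Proof.
move=> e_gal e_inj e_sum.
have [w0 w0_basis] := integral_basis_exists K.
have Zw (i : 'I_(\dim {:K})) := integral_basis_mem w0_basis (ltn_ord i).
have [d0 Dd0] := discriminant_int e_sum Zw.
have [w [w_basis Dw]] : [set d : int | exists w : (\dim {:K}).-tuple K,
    integral_basis w /\
    d%:~R = \det (\matrix_(i < \dim {:K}, j < \dim {:K})
                    galTrace 1 {:K} (w`_i * w`_j))]%classic (discriminant K).
  apply: xgetPex; exists d0; exists w0; split=> //.
  by rewrite Dd0 -(det_trace_mx e_sum).
rewrite (det_trace_mx e_sum (fun i => w`_i)) in Dw.
split; last by exists w.
rewrite -(intr_num_field_eq0 K) Dw expf_neq0 //.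
exact/(basis_conj_mx e_gal e_inj e_sum)/(w_basis.1).
Qed.

(** * Primes dividing the conductor *)

Lemma gal_restrict (K : numField) (phi : {rmorphism K -> algC})
    (nu : {rmorphism algC -> algC}) :
  exists2 g : gal_of {:K}, g \in 'Gal({:K} / 1)%g &
    forall x, phi (g x) = nu (phi x).
Proof.
have [nu0 nu0E] := restrict_aut_to_normal_num_field phi nu.
have autK : kAut 1 {:K} (linfun nu0).
  rewrite kAutfE; apply/kHom_monoid_morphism; split=> [|x y].
    by rewrite lfunE /= rmorph1.
  by rewrite !lfunE /= rmorphM.
have [g gG gE] := kAut_to_gal autK.
by exists g => // x; rewrite -nu0E -gE ?memvf // lfunE.
Qed.

(* Two rows of the matrix of conjugates of an integral basis agree modulo pi,
   so that its determinant, a square root of the discriminant, is divisible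
   by pi. *)
Lemma dvdn_discriminant (K : numField) (phi : {rmorphism K -> algC})
    (q : nat) (pi : algC) (g : gal_of {:K}) :
    prime q -> pi \in Aint -> (q %| pi ^+ q)%A ->
    g \in 'Gal({:K} / 1)%g -> g != 1%g ->
    (forall x, phi x \in Aint -> (pi %| phi (g x) - phi x)%A) ->
  (q %| `|discriminant K|)%N.
Proof.
move=> q_pr Api q_pi gG gN1 pi_g.
have [e [e_gal e_inj e_surj e_sum]] := gal_enum K.
have [_ [w [ibw Dw]]] := discriminantP e_gal e_inj e_sum.
have Zw (i : 'I_(\dim {:K})) : phi w`_i \in Aint.
  exact/ring_of_integersP/(integral_basis_mem ibw).
have [i0 Di0] := e_surj 1%g (group1 _); have [i1 Di1] := e_surj g gG.
have i10 : i0 != i1 by apply: contraNneq gN1 => i01; rewrite Di1 -i01 -Di0.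
pose V := map_mx phi (conj_mx e (fun i => w`_i))^T.
have VE i j : V i j = phi (e i w`_j) by rewrite !mxE.
have Aa j : exists a, a \in Aint /\ V i1 j = V i0 j + pi * a.
  have /dvdAP[a Aa Da] := pi_g _ (Zw j); exists a; split=> //.
  by rewrite !VE -Di0 -Di1 gal_id -Da addrC subrK.
pose a j := projT1 (cid (Aa j)).
have aP j : a j \in Aint /\ V i1 j = V i0 j + pi * a j by rewrite /a; case: cid.
pose B := \matrix_(i, j) if i == i1 then V i0 j else V i j.
pose C := \matrix_(i, j) if i == i1 then a j else V i j.
have detV : \det V = \det B + pi * \det C.
  rewrite (@determinant_multilinear _ _ V B C i1 1 pi) ?mul1r //.
  - by apply/rowP => j; rewrite !mxE eqxx mul1r -!VE (aP j).2.
  - by apply/matrixP => i j; rewrite !mxE eq_sym (negPf (neq_lift _ _)).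
  - by apply/matrixP => i j; rewrite !mxE eq_sym (negPf (neq_lift _ _)).
have detB : \det B = 0.
  by apply: (determinant_alternate i10) => j; rewrite !mxE (negPf i10) eqxx.
have detC : \det C \in Aint.
  rewrite rpred_sum // => s _; rewrite rpredMsign rpred_prod // => i _.
  rewrite mxE; case: eqP => _; first by case: (aP (s i)).
  by rewrite VE gal_Aint.
have q_V : (q %| \det V ^+ q)%A.
  apply: dvdA_trans q_pi (dvdAX q _); apply/dvdAP; exists (\det C) => //.
  by rewrite detV detB add0r.
have q_D : (q %| (discriminant K)%:~R ^+ q)%A.
  have -> : (discriminant K)%:~R = \det V ^+ 2 :> algC.
    by rewrite -(rmorph_int phi) Dw rmorphXn det_map_mx det_tr.
  rewrite -exprM mulnC exprM expr2 dvdA_mulr //.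
  rewrite detV detB add0r rpredX // rpredM //.
have q_absD : (q %| (`|discriminant K|%N)%:R ^+ q)%A.
  rewrite pmulrn abszEsign intrM exprMn mulrC dvdA_mulr // rpredX //.
  by rewrite rpred_int.
have : (q %| `|discriminant K| ^ q)%N.
  by move: q_absD; rewrite -natrX -eqAmod0 -(eqAmod0_nat q).
by rewrite Euclid_dvdX // => /andP[].
Qed.

Lemma conductorP (K : numField) : (0 < conductor K)%N ->
  in_cyclotomic K (conductor K) /\
  forall g : nat, (0 < g)%N -> in_cyclotomic K g -> (conductor K <= g)%N.
Proof.
rewrite /conductor => f_gt0.
set S := (X in xget _ X) in f_gt0 *.
have [exS|noS] := pselect (exists x, S x).
  by have [_ cyc min_f] := xgetPex 0%N exS.
by move: f_gt0; rewrite xgetPN // => x Sx; apply: noS; exists x.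
Qed.

(* If q ramified in K then K embeds in a smaller cyclotomic field unless some
   automorphism s of Q(w) fixing w^q acts non trivially on K. If q^2 divided
   the conductor then s^q = 1, while s has order p on K; hence s is a tame
   inertia element. *)
Lemma conductor_ramified (K : numField) (p q : nat) :
    \dim {:K} = p -> prime p -> prime q -> q != p ->
    q \in primes (conductor K) ->
  (q %| `|discriminant K|)%N.
Proof.
move=> dimK p_pr q_pr q_neq_p; rewrite mem_primes => /and3P[_ f_gt0 q_f].
have [[phi [z [prz phiE]]] min_f] := conductorP f_gt0.
set f := conductor K in f_gt0 q_f prz min_f *.
have [f1 Df] := dvdnP q_f; have f1_gt0 : (0 < f1)%N by case: f1 Df f_gt0 => // ->.
have [E [iota [w [Dw prw genE]]]] := cyclotomic_field_exists prz.
pose M : {subfield E} := <<1; w ^+ q>>%AS.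
have prwq : f1.-primitive_root (w ^+ q).
  by have := dvdn_prim_root prw (_ : f1 %| f)%N; rewrite Df mulKn // dvdn_mulr //; apply.
have prom : q.-primitive_root (w ^+ f1).
  have := dvdn_prim_root prw q_f; rewrite {1}Df mulnK ?prime_gt0 //.
have polyE x : exists y, phi x = iota y.
  have [h ->] := phiE x; exists (map_poly (in_alg E) h).[w].
  rewrite -Dw -horner_map -map_poly_comp; congr _.[_].
  by apply: eq_map_poly => a /=; rewrite alg_num_field fmorph_rat.
have restr s : exists2 g : gal_of {:K}, g \in 'Gal({:K} / 1)%g &
    forall x y, phi x = iota y -> phi (g x) = iota ((s : gal_of {:E}) y).
  have [nu nuE] := extend_algC_subfield_aut iota s.
  have [g gG gE] := gal_restrict phi nu.
  by exists g => // x y xy; rewrite gE xy -nuE.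
have [s [g [sM gG gN1 gE]]] : exists (s : gal_of {:E}) (g : gal_of {:K}),
    [/\ s \in 'Gal({:E} / M)%g, g \in 'Gal({:K} / 1)%g, g != 1%g &
        forall x y, phi x = iota y -> phi (g x) = iota (s y)].
  apply: contrapT => noM.
  suff /min_f : in_cyclotomic K f1.
    by move=> /(_ f1_gt0); rewrite Df leqNgt -{1}(muln1 f1) ltn_pmul2l ?prime_gt1.
  exists phi, (z ^+ q); split.
    by rewrite -Dw -rmorphXn fmorph_primitive_root.
  move=> x; have [y xy] := polyE x; rewrite xy -Dw -rmorphXn.
  apply: fAdjoin1_poly; rewrite -/(asval M).
  have /galois_fixedField <- := galois_rat M.
  apply/fixedFieldP; rewrite ?memvf // => s sM.
  have [g gG gE] := restr s; apply: (fmorph_inj iota); rewrite -(gE x) // -xy.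
  have [->|gN1] := eqVneq g 1%g; first by rewrite gal_id.
  by case: noM; exists s, g.
have co_q_f1 : coprime q f1.
  rewrite prime_coprime //; apply/negP => /dvdnP[f2 Df1].
  pose t := s w / w.
  have w_neq0 := prim_root_neq0 prw.
  have swE : s w = w * t by rewrite mulrC divfK.
  have st : s t = t.
    have /(prim_rootP prom)[i ->] : t ^+ q = 1.
      rewrite expr_div_n -rmorphXn /= (fixed_gal (subvf M) sM) ?memv_adjoin //.
      by rewrite divff // expf_neq0.
    rewrite (fixed_gal (subvf M) sM) // rpredX // Df1 mulnC exprM rpredX //.
    exact: memv_adjoin.
  have skw k : (s ^+ k)%g w = w * t ^+ k.
    elim: k => [|k IHk]; first by rewrite gal_id mulr1.
    by rewrite expgSr galM ?memvf // IHk rmorphM rmorphXn /= st swE -mulrA exprS.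
  have sq1 : (s ^+ q)%g = 1%g.
    apply: (@gal_fix_gen _ E 1%AS w) => //.
      by rewrite groupX // (fintype.subsetP (galS _ _) _ sM) // sub1v.
    rewrite skw expr_div_n -rmorphXn /= (fixed_gal (subvf M) sM) ?memv_adjoin //.
    by rewrite divff ?mulr1 // expf_neq0.
  have gk k x y : phi x = iota y -> phi ((g ^+ k)%g x) = iota ((s ^+ k)%g y).
    elim: k x y => [|k IHk] x y xy; first by rewrite !gal_id.
    by rewrite !expgSr !galM ?memvf //; apply: gE; apply: IHk.
  have gq1 : (g ^+ q)%g = 1%g.
    apply/eqP/gal_eqP => x _; have [y xy] := polyE x; apply: (fmorph_inj phi).
    by rewrite (gk q x y) // sq1 !gal_id.
  have : (#[g]%g %| gcdn q p)%N.
    rewrite dvdn_gcd order_dvdn gq1 eqxx /=.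
    by have := order_dvdG gG; rewrite -(galois_dim (galois_rat 1%AS)) dimv1 divn1 dimK.
  have /eqP-> : coprime q p by rewrite prime_coprime // dvdn_prime2.
  by rewrite dvdn1 order_eq1 (negPf gN1).
have genE' : <<M; w ^+ f1>>%VS = fullv.
  apply/eqP; rewrite eqEsubv subvf -genE /=; apply/FadjoinP; rewrite sub1v; split=> //.
  have [a _ /dvdnP[r Er]] := Bezoutl f1 (prime_gt0 q_pr).
  rewrite (eqP co_q_f1) in Er.
  have w_neq0 := prim_root_neq0 prw.
  have Ew : w = (w ^+ q) ^+ r / (w ^+ f1) ^+ a.
    by rewrite -!exprM mulnC -Er exprD expr1 mulnC mulfK // expf_neq0.
  rewrite [X in X \in _]Ew rpred_div // rpredX ?memv_adjoin //.
  exact/subvP_adjoin/memv_adjoin.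
apply: (@dvdn_discriminant K phi q (1 - iota (w ^+ f1)) g) => //.
- rewrite rpredB // (@Aint_prim_root q) // fmorph_primitive_root //.
- apply: dvdA_prim_root_pow => //.
    by rewrite -rmorphXn (prim_expr_order prom) rmorph1.
  by rewrite (@Aint_prim_root q) // fmorph_primitive_root.
move=> x; have [y xy] := polyE x; rewrite (gE _ _ xy) xy.
exact: (@tame_inertia_congr E iota q f1 (w ^+ f1) (w ^+ q)).
Qed.

(** * Reduction of integral positive definite forms *)

Definition posdef n (G : 'M[int]_n) :=
  G^T = G /\ forall v : 'rV_n, v != 0 -> 0 < (v *m G *m v^T) 0 0.

Lemma posdef_conj n (G U : 'M[int]_n) :
  posdef G -> U \in unitmx -> posdef (U *m G *m U^T).
Proof.
move=> [symG posG] uU; split=> [|v v_neq0].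
  by rewrite !trmx_mul trmxK symG mulmxA.
have := posG (v *m U); rewrite trmx_mul !mulmxA; apply.
by apply: contraNneq v_neq0 => vU0; rewrite -(mulmxK uU v) vU0 mul0mx.
Qed.

Lemma det_conj n (G U : 'M[int]_n) :
  U \in unitmx -> \det (U *m G *m U^T) = \det G.
Proof.
move=> uU; rewrite !det_mulmx det_tr mulrAC -expr2.
have : \det U \is a GRing.unit by rewrite -unitmxE.
by case/orP => /eqP->; rewrite ?sqrrN expr1n mul1r.
Qed.

Lemma conj_entry n (G : 'M[int]_n) i :
  (delta_mx 0 i *m G *m (delta_mx 0 i)^T) (0 : 'I_1) (0 : 'I_1) = G i i.
Proof. by rewrite -rowE trmx_delta -colE !mxE. Qed.

Lemma posdef_diag n (G : 'M[int]_n) i : posdef G -> 0 < G i i.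
Proof.
move=> [_ posG]; rewrite -(conj_entry G i); apply: posG.
by apply/eqP => /rowP/(_ i); rewrite !mxE !eqxx.
Qed.

(* g times the Gram matrix of the projection orthogonal to the first vector,
   whose square norm is g. *)
Definition schur n (G : 'M[int]_(1 + n)) : 'M[int]_n :=
  G 0 0 *: drsubmx G - (ursubmx G)^T *m ursubmx G.

Section Schur.

Variables (n : nat) (G : 'M[int]_(1 + n)).
Hypothesis posG : posdef G.
Let g := G 0 0.
Let r := ursubmx G.
Let S := drsubmx G.

Let lshift00 : lshift n (0 : 'I_1) = 0 :> 'I_(1 + n).
Proof. exact: val_inj. Qed.

Let ulG : ulsubmx G = g%:M.
Proof.
by apply/matrixP => i j; rewrite !ord1 !mxE eqxx mulr1n lshift00.
Qed.

Let G_block : G = block_mx g%:M r r^T S.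
Proof.
rewrite -[LHS]submxK ulG; congr block_mx.
by rewrite -[in LHS](posG.1) /r trmx_ursub.
Qed.

Lemma det_schur : g ^+ n * \det G = g * \det (schur G).
Proof.
pose L : 'M[int]_(1 + n) := block_mx 1%:M 0 (- r^T) g%:M.
have LG : L *m G = block_mx g%:M r 0 (schur G).
  rewrite {1}G_block mulmx_block !mul1mx !mul0mx !addr0 !mulNmx !mul_scalar_mx.
  by rewrite mul_mx_scalar addNr addrC.
have := congr1 determinant LG; rewrite det_mulmx det_lblock det_ublock.
by rewrite det1 mul1r !det_scalar expr1.
Qed.

Lemma posdef_schur : posdef (schur G).
Proof.
have g_gt0 : 0 < g by apply: posdef_diag.
have symS : S^T = S by rewrite /S trmx_drsub posG.1.
split=> [|v v_neq0]; first by rewrite /schur linearB linearZ /= trmx_mul trmxK symS.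
pose k := (v *m r^T) 0 0.
pose u : 'rV[int]_(1 + n) := row_mx (- k)%:M (g *: v).
have u_neq0 : u != 0.
  apply: contraNneq v_neq0 => /(congr1 rsubmx); rewrite row_mxKr linear0 => /eqP.
  by rewrite scalemx_eq0 gt_eqF.
have Dk : v *m r^T = k%:M by rewrite [LHS]mx11_scalar.
have Dk' : r *m v^T = k%:M by rewrite -(trmxK r) -trmx_mul Dk tr_scalar_mx.
have uG : u *m G = row_mx 0 (g *: (v *m S) - k *: r).
  rewrite G_block mul_row_block -!scalemxAl Dk !mul_scalar_mx !scaleNr.
  congr row_mx; last by rewrite addrC.
  by rewrite !scale_scalar_mx mulrC addNr.
have := posG.2 u u_neq0; rewrite uG tr_row_mx mul_row_col mul0mx add0r [(g *: v)^T]linearZ /=.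
rewrite -scalemxAr mxE pmulr_rgt0 // mulmxBl -!scalemxAl Dk'.
rewrite /schur mulmxBr mulmxBl -scalemxAr -scalemxAl -/S mulmxA -/r Dk.
by rewrite -(mulmxA k%:M) Dk' mul_scalar_mx.
Qed.

Lemma schur_diag j : g * G (rshift 1 j) (rshift 1 j)
  = schur G j j + G 0 (rshift 1 j) ^+ 2.
Proof.
rewrite /schur !mxE big_ord1 !mxE -/g lshift00.
by rewrite expr2 subrK.
Qed.

Lemma schur_conj (U : 'M[int]_n) (c : 'cV[int]_n) : U \in unitmx ->
  exists V : 'M[int]_(1 + n), let G' := V *m G *m V^T in
    [/\ V \in unitmx, G' 0 0 = g, schur G' = U *m schur G *m U^T &
        forall j, G' 0 (rshift 1 j) = (r *m U^T) 0 j - g * c j 0].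
Proof.
move=> uU; pose V : 'M[int]_(1 + n) := block_mx 1%:M 0 (- c) U.
have VG : V *m G *m V^T = block_mx g%:M (r *m U^T - g *: c^T)
    ((r *m U^T - g *: c^T)^T)
    (U *m S *m U^T - c *m (r *m U^T) - (c *m (r *m U^T))^T + g *: (c *m c^T)).
  rewrite {1}G_block /V tr_block_mx !mulmx_block !trmx1 !trmx0 !mul1mx !mul0mx.
  rewrite !mulmx1 !mulmx0 !addr0 linearN /= mulmxN.
  congr block_mx.
  - by rewrite mul_scalar_mx addrC.
  - rewrite linearB linearZ /= trmx_mul !trmxK mulNmx mul_mx_scalar addrC //.
  - rewrite !trmx_mul !trmxK !mulmxDl !mulNmx !mulmxN.
    rewrite mul_mx_scalar -scalemxAl !mulmxA.
    rewrite opprK; set A := U *m S *m _; set B := c *m r *m _.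
    set C := U *m r^T *m _; set D := g *: _.
    by rewrite [RHS]addrC [A - B - C]addrC addrA [A - B]addrC.
have V00 : (V *m G *m V^T) 0 0 = g.
  by rewrite VG -lshift00 block_mxEul mxE eqxx.
exists V; split=> //=.
- by rewrite unitmxE det_lblock det1 mul1r -unitmxE.
- rewrite /schur V00 VG block_mxKdr block_mxKur.
  have -> : U *m (G 0 0 *: drsubmx G - (ursubmx G)^T *m ursubmx G) *m U^T =
      g *: (U *m S *m U^T) - (r *m U^T)^T *m (r *m U^T).
    rewrite mulmxBr mulmxBl -scalemxAr -scalemxAl.
    by rewrite trmx_mul trmxK !mulmxA.
  set A := U *m S *m _; set rho := r *m _.
  by apply/matrixP => i j; rewrite !mxE !big_ord1 !mxE; ring.
- by move=> j; rewrite VG -lshift00 block_mxEur !mxE.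
Qed.

End Schur.

Lemma int_round (r g : int) : 0 < g -> exists c, (r - g * c) ^+ 2 *+ 4 <= g ^+ 2.
Proof.
move=> g_gt0; exists ((r *+ 2 + g) %/ (g *+ 2))%Z.
have g2_neq0 : g *+ 2 != 0 by lia.
have := divz_eq (r *+ 2 + g) (g *+ 2).
have := modz_ge0 (r *+ 2 + g) g2_neq0.
have := ltz_pmod (r *+ 2 + g) (_ : 0 < g *+ 2); rewrite pmulrn_lgt0 // => /(_ g_gt0).
set m := (_ %% _)%Z; set c := (_ %/ _)%Z => m_lt m_ge Dr; nia.
Qed.

(* Take a basis whose first vector has minimal norm g; if g' is the norm of a
   short vector for the Schur complement, lifting that vector gives g^2 <= g' + g^2 / 4. *)
Lemma posdef_hermite n : exists2 k : int, 0 < k &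
  forall G : 'M[int]_(1 + n), posdef G ->
  exists2 U : 'M[int]_(1 + n), U \in unitmx &
    (U *m G *m U^T) 0 0 ^+ n.+1 <= k * \det G.
Proof.
elim: n => [|n [k k_gt0 IHn]].
  exists 1 => // G _; exists 1%:M; rewrite ?unitmx1 // trmx1 mul1mx mulmx1.
  by rewrite (@det_mx11 _ (G : 'M_1)) expr1 mul1r.
exists (2 ^+ n.+1 * k); first by rewrite mulr_gt0 ?exprn_gt0.
move=> G posG.
have [g [U1 [uU1 Dg] min_g]] : exists g : int, exists2 U : 'M[int]_(1 + n.+1),
    U \in unitmx /\ (U *m G *m U^T) 0 0 = g &
    forall U' : 'M[int]_(1 + n.+1), U' \in unitmx -> g <= (U' *m G *m U'^T) 0 0.
  pose P m := `[< exists2 U : 'M[int]_(1 + n.+1), U \in unitmx &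
                  (U *m G *m U^T) 0 0 = m%:Z >].
  have absP (U : 'M[int]_(1 + n.+1)) : U \in unitmx ->
      ((absz ((U *m G *m U^T) 0 0)) : int) = (U *m G *m U^T) 0 0.
    by move=> uU; rewrite abszE gtr0_norm // posdef_diag //; apply: posdef_conj.
  have PU U : U \in unitmx -> P (absz ((U *m G *m U^T) 0 0)).
    by move=> uU; apply/asboolP; exists U; rewrite ?absP.
  have exP : exists m, P m by eexists; apply: (PU 1%:M); apply: unitmx1.
  case: (ex_minnP exP) => m /asboolP[U uU Dm] min_m.
  by exists m; exists U => // U' uU'; rewrite -absP // lez_nat min_m ?PU.
set G1 := U1 *m G *m U1^T in Dg; exists U1 => //; rewrite -/G1 Dg.
have posG1 : posdef G1 by apply: posdef_conj.
have g_gt0 : 0 < g by rewrite -Dg posdef_diag.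
have [U2 uU2] := IHn _ (posdef_schur posG1).
set g' := (_ *m _) 0 0 => le_g'.
pose row2 := ursubmx G1 *m U2^T.
pose c := \col_j projT1 (cid (int_round (row2 0 j) g_gt0)).
have cP j : (row2 0 j - g * c j 0) ^+ 2 *+ 4 <= g ^+ 2.
  by rewrite [c j 0]mxE; case: cid.
have [V [uV V00 Vschur V0j]] := schur_conj posG1 c uU2.
set G2 := V *m G1 *m V^T in V00 Vschur V0j.
have := schur_diag G2 0; rewrite V00 Vschur V0j Dg -/g' -/row2.
have := cP 0; set rho := _ - _ => rho_le diag2.
have g_le : g <= G2 (rshift 1 0) (rshift 1 0).
  pose s := tperm 0 (rshift 1 (0 : 'I_n.+1)) : 'S_(1 + n.+1).
  have -> : G2 (rshift 1 0) (rshift 1 0) = (perm_mx s *m G2 *m (perm_mx s)^T) 0 0.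
    by rewrite tr_perm_mx -col_permE -row_permE !mxE tpermL.
  have := min_g (perm_mx s *m V *m U1).
  by rewrite !unitmx_mul unitmx_perm uV uU1 /G2 /G1 !trmx_mul !mulmxA; apply.
have g2_le : g ^+ 2 <= 2 * g'.
  have := sqr_ge0 g; have : g ^+ 2 <= g * G2 (rshift 1 0) (rshift 1 0).
    by rewrite expr2 ler_pM2l.
  by rewrite diag2; move: rho_le; move: (rho ^+ 2) (g ^+ 2) => x y; lia.
have := det_schur posG1; rewrite Dg (det_conj G uU1) => Ddet.
have det_le : (g ^+ 2) ^+ n.+1 <= 2 ^+ n.+1 * (k * \det (schur G1)).
  apply: le_trans (_ : (2 * g') ^+ n.+1 <= _).
    by rewrite lerXn2r ?nnegrE ?sqr_ge0 ?(le_trans _ g2_le) ?sqr_ge0.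
  by rewrite exprMn ler_pM2l ?exprn_gt0.
rewrite -(ler_pM2l (exprn_gt0 n.+1 g_gt0)).
apply: le_trans (_ : g * (g ^+ 2) ^+ n.+1 <= _).
  rewrite -exprM -exprS -exprD (_ : (n.+1 + n.+2)%N = (2 * n.+1).+1) //; lia.
have := ler_wpM2l (ltW g_gt0) det_le => /le_trans; apply.
have -> : g * (2 ^+ n.+1 * (k * \det (schur G1))) = 2 ^+ n.+1 * k * (g * \det (schur G1)).
  by ring.
by rewrite -Ddet mulrCA.
Qed.

Lemma posdef_reduction n (d : int) : exists b : int,
  forall G : 'M[int]_(1 + n), posdef G -> \det G <= d ->
  exists2 U : 'M[int]_(1 + n), U \in unitmx &
    forall i, (U *m G *m U^T) i i <= b.
Proof.
elim: n d => [|n IHn] d.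
  exists d => G _ le_d; exists 1%:M; rewrite ?unitmx1 // => i.
  rewrite trmx1 mul1mx mulmx1; move: le_d.
  by rewrite (@det_mx11 _ (G : 'M_1)) (ord1 (i : 'I_1)).
have [k k_gt0 kP] := posdef_hermite n.+1.
pose gam := k * `|d|.
have [b bP] := IHn (gam ^+ n.+1 * `|d|).
exists (`|b| + gam ^+ 2 + gam) => G posG le_d.
have [U1 uU1] := kP G posG.
set G1 := U1 *m G *m U1^T; have posG1 : posdef G1 by apply: posdef_conj.
have g_gt0 : 0 < G1 0 0 by rewrite posdef_diag.
move Dg: (G1 0 0) g_gt0 => g g_gt0 g_le.
have detS := det_schur posG1; rewrite Dg (det_conj G uU1) in detS.
have g_le_gam : g <= gam.
  apply: le_trans (_ : g ^+ n.+2 <= _).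
    by rewrite -[X in X <= _]expr1 ler_weXn2l //; lia.
  apply: le_trans g_le _; rewrite /gam; rewrite ler_pM2l //.
  exact: le_trans le_d (ler_norm _).
have [U2 uU2 U2P] : exists2 U2 : 'M[int]_(1 + n), U2 \in unitmx &
    forall i, (U2 *m schur G1 *m U2^T) i i <= b.
  apply: bP; first exact: posdef_schur.
  have : \det (schur G1) <= g * \det (schur G1) \/ \det (schur G1) <= 0.
    by have [|?] := lerP (\det (schur G1)) 0; [right | left; nia].
  have pd : 0 <= gam ^+ n.+1 * `|d| by rewrite mulr_ge0 ?exprn_ge0 // (le_trans (ltW g_gt0)).
  case => [le_gd | /le_trans]; last exact.
  apply: le_trans le_gd _; rewrite -detS.
  apply: le_trans (_ : g ^+ n.+1 * `|d| <= _).
    by rewrite ler_pM2l ?exprn_gt0 // (le_trans le_d) // ler_norm.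
  by rewrite ler_wpM2r // lerXn2r ?nnegrE // ltW // (lt_le_trans g_gt0).
pose row2 := ursubmx G1 *m U2^T.
pose c := \col_j projT1 (cid (int_round (row2 0 j) g_gt0)).
have cP j : (row2 0 j - g * c j 0) ^+ 2 *+ 4 <= g ^+ 2.
  by rewrite [c j 0]mxE; case: cid.
have [V [uV V00 Vschur V0j]] := schur_conj posG1 c uU2.
exists (V *m U1); first by rewrite unitmx_mul uV.
move=> i.
have -> : V *m U1 *m G *m (V *m U1)^T = V *m G1 *m V^T.
  by rewrite /G1 trmx_mul !mulmxA.
set G2 := V *m G1 *m V^T in V00 Vschur V0j *.
case: (splitP i) => j Dj.
  have -> : i = 0 by apply: val_inj; rewrite /= Dj (ord1 j).
  by rewrite V00 Dg; nia.
have -> : i = rshift 1 j by apply: val_inj.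
have := schur_diag G2 j; rewrite V00 Vschur V0j Dg -/row2.
have := cP j; have := U2P j; set rho := _ - _ => b_le rho_le diag2.
have b_norm := ler_norm b; have rho_ge0 := sqr_ge0 rho.
have gam2 : g ^+ 2 <= gam ^+ 2 by nia.
set X := G2 _ _ in diag2 *.
have [X_le0|X_gt0] := lerP X 0; first by nia.
have : X <= g * X by nia.
by rewrite diag2; move: b_le rho_le; set y := (_ *m _) j j; move: y => y; lia.
Qed.

(** * Finiteness of the fields of bounded discriminant *)

Lemma prime_dim_generator (K : numField) p (a : K) :
    prime p -> \dim {:K} = p -> a \notin 1%VS ->
  <<1; a>>%VS = fullv /\ size (minPoly 1 a) = p.+1.
Proof.
move=> p_pr dimK a_notin.
have genK : <<1; a>>%VS = fullv.
  apply/eqP; rewrite eqEdim subvf /= dimK.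
  have : (\dim <<1%AS; a>> %| p)%N by rewrite -dimK field_dimS // subvf.
  move/primeP: p_pr => [_ /[apply]] => /orP[/eqP dim1|/eqP-> //].
  case/negP: a_notin; have -> : 1%VS = <<1; a>>%VS.
    by apply/eqP; rewrite eqEdim subv_adjoin dim1 dimv1.
  exact: memv_adjoin.
split=> //; rewrite size_minPoly.
by rewrite adjoin_degreeE genK dimv1 divn1 dimK.
Qed.

Section GramMatrix.

Variables (K : numField) (phi : {rmorphism K -> algC}).
Hypothesis abelK : abelian 'Gal({:K} / 1)%g.
Let n := \dim {:K}.

(* Complex conjugation comes from an element of the abelian group Gal(K/Q), so
   that the sum is a trace. *)
Lemma gram_int x y : phi x \in Aint -> phi y \in Aint ->
  \sum_(g in 'Gal({:K} / 1)%g) phi (g x) * (phi (g y))^* \in Num.int.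
Proof.
move=> Ax Ay; have [c cG cE] := gal_restrict phi Num.conj.
have -> : \sum_(g in 'Gal({:K} / 1)%g) phi (g x) * (phi (g y))^* =
          phi (galTrace 1 {:K} (x * c y)).
  rewrite rmorph_sum; apply: eq_bigr => g gG; rewrite !rmorphM -cE.
  by rewrite -galM ?memvf // (centsP abelK _ gG _ cG) galM ?memvf.
by apply: galTrace_int; rewrite rmorphM rpredM // gal_Aint.
Qed.

(* The Gram matrix of an integral basis for the form of gram_int has determinant
   |D|; reduce it. *)
Lemma small_generators (d : nat) (b : int) :
    (forall G : 'M[int]_n, posdef G -> \det G <= d ->
      exists2 U : 'M[int]_n, U \in unitmx & forall i, (U *m G *m U^T) i i <= b) ->
    (1 < n)%N -> (`|discriminant K| <= d)%N ->
  exists a : K, [/\ phi a \in Aint, a \notin 1%VS &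
    forall g, g \in 'Gal({:K} / 1)%g -> `|phi (g a)| ^+ 2 <= b%:~R].
Proof.
move=> bP n_gt1 le_d.
have [e [e_gal e_inj e_surj e_sum]] := gal_enum K.
have [D_neq0 [w [ibw Dw]]] := discriminantP e_gal e_inj e_sum.
rewrite -/n in e e_gal e_inj e_surj e_sum w ibw Dw *.
have Zw (i : 'I_n) : phi w`_i \in Aint.
  exact/ring_of_integersP/(integral_basis_mem ibw).
pose W := map_mx phi (conj_mx e (fun i => w`_i)).
pose Wc := map_mx Num.conj W.
have gij (i j : 'I_n) : exists m : int, m%:~R = (W *m Wc^T) i j.
  have /intrP[m Dm] := gram_int (Zw i) (Zw j); exists m; rewrite -Dm e_sum mxE.
  by apply: eq_bigr => k _; rewrite !mxE.
pose G := \matrix_(i, j) projT1 (cid (gij i j)).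
have GE : map_mx intr G = W *m Wc^T.
  by apply/matrixP => i j; rewrite [LHS]mxE [G i j]mxE; case: cid.
clearbody G.
have detW : \det W ^+ 2 = (discriminant K)%:~R.
  by rewrite -(rmorph_int phi) Dw rmorphXn det_map_mx.
have uW : W \in unitmx.
  rewrite unitmxE unitfE; apply: contra D_neq0 => /eqP W0.
  by rewrite -(intr_eq0 algC) -detW W0 expr0n.
have formE (v : 'rV[int]_n) :
    ((v *m G *m v^T) 0 0)%:~R = \sum_i `|(map_mx intr v *m W) 0 i| ^+ 2 :> algC.
  have -> : ((v *m G *m v^T) 0 0)%:~R = (map_mx intr (v *m G *m v^T)) 0 0 :> algC.
    by rewrite [RHS]mxE.
  rewrite !map_mxM /= GE -map_trmx mulmxA -mulmxA -trmx_mul mxE.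
  have -> : map_mx intr v *m Wc = map_mx Num.conj (map_mx intr v *m W).
    rewrite map_mxM; congr (_ *m _).
    by apply/matrixP => k l; rewrite !mxE rmorph_int.
  by apply: eq_bigr => i _; rewrite normCK [_^T i 0]mxE [map_mx Num.conj _ 0 i]mxE.
have posG : posdef G.
  split=> [|v v_neq0].
    have symG : map_mx intr G^T = map_mx intr G :> 'M[algC]_n.
      rewrite -map_trmx GE trmx_mul trmxK; apply/matrixP => i j.
      have [m Dm] := gij i j; rewrite -Dm -[RHS](rmorph_int Num.conj) Dm.
      rewrite !mxE rmorph_sum; apply: eq_bigr => k _.
      by rewrite !mxE rmorphM /= conjCK mulrC.
    apply/matrixP => i j; have /matrixP/(_ i j) := symG; rewrite !mxE => /eqP.
    by rewrite eqr_int => /eqP.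
  rewrite -(ltr0z algC) formE lt_def sumr_ge0 ?andbT; last first.
    by move=> i _; rewrite exprn_ge0.
  apply: contraNneq v_neq0 => /eqP; rewrite psumr_eq0 => [/allP vW0|i _]; last first.
    by rewrite exprn_ge0.
  have vW : map_mx intr v *m W = 0.
    apply/rowP => i; rewrite [RHS]mxE; apply/eqP; rewrite -normr_eq0 -sqrf_eq0.
    exact: vW0 (mem_index_enum i).
  have := congr1 (mulmx^~ (invmx W)) vW; rewrite mulmxK // mul0mx => v0.
  apply/eqP/rowP => i; have /rowP/(_ i) := v0; rewrite !mxE => /eqP.
  by rewrite intr_eq0 => /eqP.
have detG : \det G = `|discriminant K|%N.
  apply/eqP; rewrite -(eqr_int algC) -det_map_mx GE det_mulmx det_tr [\det Wc]det_map_mx.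
  by rewrite -normCK abszE intr_norm -detW normrX.
have [|U uU UP] := bP G posG; first by rewrite detG lez_nat.
pose a (i : 'I_n) := \sum_(j < n) w`_j *~ U i j.
have Aa i : phi (a i) \in Aint.
  by rewrite rmorph_sum rpred_sum // => j _; rewrite rmorphMz rpredMz.
have aE i k : phi (e k (a i)) = (map_mx intr (row i U) *m W) 0 k.
  rewrite !mxE !rmorph_sum; apply: eq_bigr => j _.
  by rewrite !mxE !rmorphMz mulrzl.
have [i a_i] : exists i, a i \notin 1%VS.
  apply: contrapT => all_in.
  have a1 i : a i \in 1%VS by apply/negPn/negP => ai; apply: all_in; exists i.
  have w1 (j : 'I_n) : w`_j \in 1%VS.
    have -> : w`_j = \sum_i a i *~ (invmx U) j i.
      under eq_bigr => i _ do rewrite mulrz_suml.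
      rewrite exchange_big /=.
      rewrite (eq_bigr (fun k : 'I_n => w`_k *~ (invmx U *m U) j k)) => [|k _].
        rewrite mulVmx // (bigD1 j) //= mxE eqxx mulr1z big1 ?addr0 // => k /negPf kj.
        by rewrite mxE eq_sym kj mulr0z.
      rewrite mxE mulrz_sumr; apply: eq_bigr => i _.
      by rewrite -mulrzA mulrC.
    by rewrite rpred_sum // => i _; rewrite rpredMz.
  have /dimvS : ({:K} <= 1%VS)%VS.
    have /andP[/eqP span_w _] := ibw.1; rewrite -span_w; apply/span_subvP => x /(nthP 0)[j].
    by rewrite size_tuple => lt_jn <-; apply: (w1 (Ordinal lt_jn)).
  by rewrite dimv1 leqNgt n_gt1.
exists (a i); split=> // g gG; have [k ->] := e_surj g gG.
apply: le_trans (_ : ((U *m G *m U^T) i i)%:~R <= _); last by rewrite ler_int.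
have -> : (U *m G *m U^T) i i = (row i U *m G *m (row i U)^T) 0 0.
  by rewrite !rowE -(conj_entry (U *m G *m U^T) i) !trmx_mul !mulmxA.
rewrite formE (bigD1 k) //= -aE lerDl sumr_ge0 // => l _.
by rewrite exprn_ge0.
Qed.

End GramMatrix.

Lemma isomorphic_minPoly p (K L : numField) (a : K) (b : L) (Q : {poly int}) :
    prime p -> \dim {:K} = p -> \dim {:L} = p -> a \notin 1%VS -> b \notin 1%VS ->
    minPoly 1 a = map_poly intr Q -> minPoly 1 b = map_poly intr Q ->
  isomorphic K L.
Proof.
move=> p_pr dimK dimL a_notin b_notin Da Db.
have [genK _] := prime_dim_generator p_pr dimK a_notin.
have [genL _] := prime_dim_generator p_pr dimL b_notin.
have mapQ (M : numField) :
    map_poly (in_alg M) (map_poly intr Q) = map_poly intr Q.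
  rewrite -map_poly_comp; apply: eq_map_poly => m /=.
  by rewrite alg_num_field ratr_int.
have [h ha | f fab] := @num_field_morph K L (in_alg L) a b genK.
  have /dvdpP[r ->] : map_poly intr Q %| h.
    rewrite -(dvdp_map (in_alg K)) /= mapQ -Da minPoly_dvdp //; last exact/rootP.
    by apply/polyOver1P; exists h.
  have /rootP Qb : root (map_poly intr Q : {poly L}) b by rewrite -Db root_minPoly.
  by rewrite rmorphM hornerM /= mapQ Qb mulr0.
have f_surj y : exists x, f x = y.
  have : y \in <<1; b>>%VS by rewrite genL memvf.
  move=> /Fadjoin_polyP[q /polyOver1P[h ->] ->].
  exists (map_poly (in_alg K) h).[a]; rewrite -horner_map /= fab.
  rewrite -map_poly_comp; congr _.[_].
  by apply: eq_map_poly => c /=; rewrite !alg_num_field fmorph_rat.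
exists f; exists (fun y => projT1 (cid (f_surj y))) => [x|y]; last by case: cid.
by apply: (fmorph_inj f); case: cid.
Qed.

Lemma coef_prod_XsubC_le (F : numDomainType) (s : seq F) (r : F) k :
  0 <= r -> {in s, forall z, `|z| <= r} ->
  `|(\prod_(z <- s) ('X - z%:P))`_k| <= (1 + r) ^+ size s.
Proof.
move=> r_ge0; elim: s k => [|z s IHs] k s_le.
  by rewrite big_nil expr0 coef1; case: eqP; rewrite ?normr1 // normr0 ler01.
have {}IHs j := IHs j (fun t ts => s_le t (mem_behead (s := z :: s) ts)).
have z_le := s_le z (mem_head _ _).
rewrite big_cons mulrBl coefB coefXM coefCM /= exprS mulrDl mul1r.
apply: le_trans (ler_normB _ _) (lerD _ _).
  by case: k => [|k]; rewrite /= ?normr0 ?exprn_ge0 ?addr_ge0.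
by rewrite normrM ler_pM.
Qed.

Lemma minPoly_int_bounded (K : numField) (phi : {rmorphism K -> algC}) p (a : K) (b : int) :
    phi a \in Aint -> size (minPoly 1 a) = p.+1 ->
    (forall g, g \in 'Gal({:K} / 1)%g -> `|phi (g a)| ^+ 2 <= b%:~R) ->
  exists2 Q : {poly int}, minPoly 1 a = map_poly intr Q &
    forall k, `|Q`_k| <= (2 + `|b|) ^+ p.
Proof.
move=> Aa sz_a le_b.
have /(normalField_factors (sub1v _)) := normalFieldf (1%AS : {subfield K}).
move=> /(_ a (memvf _))[r /fintype.subsetP r_gal Dr].
have size_r : size r = p.
  by apply/eqP; rewrite -eqSS -sz_a Dr size_prod_XsubC.
have phiP : map_poly phi (minPoly 1 a) =
    \prod_(z <- [seq phi (g a) | g : gal_of {:K} <- r]) ('X - z%:P).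
  rewrite Dr rmorph_prod big_map; apply: eq_bigr => g _.
  by rewrite rmorphB /= map_polyX map_polyC.
have /floorpP[Q DQ] : map_poly phi (minPoly 1 a) \is a polyOver Num.int.
  apply/polyOverP => k; apply: Cint_rat_Aint.
    rewrite coef_map; have /polyOver1P[h ->] := minPolyOver 1 a.
    by rewrite coef_map /= alg_num_field fmorph_rat Crat_rat.
  have : \prod_(z <- [seq phi ((g : gal_of {:K}) a) | g <- r]) ('X - z%:P) \is a polyOver Aint.
    rewrite big_map big_seq rpred_prod // => g _.
    by rewrite polyOverXsubC gal_Aint.
  by rewrite -phiP => /polyOverP.
have inj_map : injective (map_poly phi).
  exact: map_inj_poly (fmorph_inj phi) (rmorph0 phi).
exists Q.
  apply: inj_map; rewrite DQ -map_poly_comp; apply: eq_map_poly => m /=.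
  by rewrite rmorph_int.
move=> k; rewrite -(ler_int algC) intr_norm.
have -> : (Q`_k)%:~R = (map_poly phi (minPoly 1 a))`_k by rewrite DQ coef_map.
rewrite phiP rmorphXn /= intrD -size_r -(size_map (fun g : gal_of {:K} => phi (g a))).
rewrite -[2%:~R]/(1 + 1) -addrA; apply: coef_prod_XsubC_le.
  by rewrite addr_ge0 // ler0z.
move=> _ /mapP[g rg ->].
have b_ge0 : 0 <= b.
  by rewrite -(ler0z algC) (le_trans _ (le_b g (r_gal g rg))) ?exprn_ge0.
rewrite (ger0_norm b_ge0); apply: le_trans _ (lerD (lexx 1) (le_b g (r_gal g rg))).
set x := `|_|; rewrite -subr_ge0 (_ : _ - x = (x - 1) ^+ 2 + x); last by ring.
by rewrite addr_ge0 ?normr_ge0 // real_exprn_even_ge0 // rpredB ?normr_real ?rpred1.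
Qed.

Lemma hermite_finiteness p (d : nat) : prime p ->
  exists (m : nat) (L : 'I_m -> numField), forall K : numField,
    \dim {:K} = p -> abelian 'Gal({:K} / 1)%g ->
    (`|discriminant K| <= d)%N -> exists i, isomorphic K (L i).
Proof.
move=> p_pr.
have [b bP] : exists b : int, forall G : 'M[int]_p, posdef G -> \det G <= d ->
    exists2 U : 'M[int]_p, U \in unitmx & forall i, (U *m G *m U^T) i i <= b.
  by case: p p_pr => // n _; apply: (posdef_reduction n d).
pose B := absz ((2 + `|b|) ^+ p); pose T := {ffun 'I_p.+1 -> 'I_(B + B).+1}.
pose decode (t : T) : {poly int} := \poly_(k < p.+1) ((t (inord k))%:Z - B%:Z).
pose good (t : T) (K : numField) :=
  [/\ \dim {:K} = p & exists2 a : K, a \notin 1%VS & minPoly 1 a = map_poly intr (decode t)].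
have goodP (K : numField) :
    \dim {:K} = p -> abelian 'Gal({:K} / 1)%g ->
    (`|discriminant K| <= d)%N -> exists t, good t K.
  move=> dimK abelK le_d; have [phi _] := algC_embedding K.
  have bP' := bP; rewrite -dimK in bP'.
  have n_gt1 : (1 < \dim {:K})%N by rewrite dimK prime_gt1.
  have [a [Aa a_notin le_b]] := small_generators phi abelK bP' n_gt1 le_d.
  have [_ sz_a] := prime_dim_generator p_pr dimK a_notin.
  have [Q DQ Q_le] := minPoly_int_bounded Aa sz_a le_b.
  have B_ge (k : nat) : (0 <= Q`_k + B%:Z) /\ (absz (Q`_k + B%:Z)%R < (B + B).+1)%N.
    have : (2 + `|b|) ^+ p = B%:Z by rewrite /B gez0_abs // exprn_ge0 // addr_ge0.
    by have := Q_le k; lia.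
  exists [ffun k : 'I_p.+1 => inord (absz (Q`_k + B%:Z))]; split=> //; exists a => //.
  rewrite DQ; congr map_poly; apply/polyP => k; rewrite coef_poly.
  have size_Q : size Q = p.+1.
    rewrite -sz_a DQ size_map_poly_id0 // intr_num_field_eq0 lead_coef_eq0.
    apply: contraNneq (monic_neq0 (monic_minPoly 1%AS a)) => Q0.
    by rewrite DQ Q0 rmorph0.
  case: ltnP => [lt_kp|le_pk]; last by rewrite nth_default ?size_Q.
  rewrite ffunE !inordK //; last by case: (B_ge k).
  by rewrite gez0_abs; [rewrite addrK | case: (B_ge k)].
have [[K0 _]|noK] := pselect (exists K : numField, \dim {:K} = p); last first.
  exists 0%N; exists (fun i : 'I_0 => match notF (ltn_ord i) with end) => K dimK.
  by case: noK; exists K.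
pose L (i : 'I_#|{: T}|) := if pselect (exists K, good (enum_val i) K) is left h
                            then projT1 (cid h) else K0.
exists #|{: T}|, L => K dimK abelK le_d.
have [t [_ [a a_notin Da]]] := goodP K dimK abelK le_d.
exists (enum_rank t); rewrite /L enum_rankK; case: pselect => [h|]; last first.
  by case; exists K; split=> //; exists a.
case: cid => M [dimM [c c_notin Dc]] /=.
exact: isomorphic_minPoly p_pr dimK dimM a_notin c_notin Da Dc.
Qed.

(** * Invariance under isomorphism *)

Section IsomorphismInvariance.
Local Open Scope classical_set_scope.

Lemma gal_transport (K L : numField) (f : {rmorphism K -> L}) (s : gal_of {:K}) :
  exists2 t : gal_of {:L}, t \in 'Gal({:L} / 1)%g & forall x, t (f x) = f (s x).
Proof.
have [phi _] := algC_embedding L.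
have [nu nuE] := extend_algC_subfield_aut (phi \o f) s.
have [t tG tE] := gal_restrict phi nu; exists t => // x.
by apply: (fmorph_inj phi); rewrite tE -nuE.
Qed.

Lemma rmorphism_inverse (K L : numField) (f : {rmorphism K -> L}) g :
  cancel f g -> cancel g f -> exists g' : {rmorphism L -> K}, g' =1 g.
Proof.
move=> fK gK.
have gB : zmod_morphism g by move=> x y; apply: (can_inj fK); rewrite rmorphB !gK.
have gM : monoid_morphism g.
  by split=> [|x y]; apply: (can_inj fK); rewrite ?rmorph1 ?rmorphM !gK.
pose gA := GRing.isZmodMorphism.Build L K g gB.
pose gMM := GRing.isMonoidMorphism.Build L K g gM.
pose g' : {rmorphism L -> K} := HB.pack g gA gMM.
by exists g'.
Qed.

Lemma card_fset_set_image (T U : choiceType) (f : T -> U) (g : U -> T) (A : set T) :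
  cancel f g -> #|` fset_set (f @` A)| = #|` fset_set A|.
Proof.
move=> fK; have [finA | infA] := pselect (finite_set A).
  by rewrite fset_set_image // card_imfset //; apply: can_inj fK.
rewrite /fset_set; case: pselect => [finfA|_]; case: pselect => // _.
case: infA; suff -> : A = g @` (f @` A) by apply: finite_image.
by rewrite image_comp (eq_imagel (f' := id)) ?image_id // => x _ /=; rewrite fK.
Qed.

Section Transport.

Variables (K L : numField) (f : {rmorphism K -> L}) (g : {rmorphism L -> K}).
Hypotheses (fK : cancel f g) (gK : cancel g f).

Lemma gal_bij : exists h : gal_of {:K} -> gal_of {:L},
  [/\ injective h, h @: 'Gal({:K} / 1)%g = 'Gal({:L} / 1)%g &
      forall s x, h s (f x) = f (s x)].
Proof.
pose h s := s2val (cid2 (gal_transport f s)).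
have hG s : h s \in 'Gal({:L} / 1)%g by rewrite /h; case: cid2.
have hE s x : h s (f x) = f (s x) by rewrite /h; case: cid2.
exists h; split=> //.
  move=> s t st; apply/eqP/gal_eqP => x _; apply: (fmorph_inj f).
  by rewrite -!hE st.
apply/setP => t; apply/imsetP/idP => [[s _ ->] // | tG].
have [s sG sE] := gal_transport g t; exists s => //.
by apply/eqP/gal_eqP => y _; rewrite -{2}(gK y) hE sE gK.
Qed.

Lemma dim_transport : \dim {:L} = \dim {:K}.
Proof.
have [h [h_inj hG _]] := gal_bij.
have := galois_dim (galois_rat (1%AS : {subfield L})).
have := galois_dim (galois_rat (1%AS : {subfield K})).
by rewrite /= !dimv1 !divn1 -hG (card_imset _ h_inj) => -> ->.
Qed.

Lemma galTrace_transport x : galTrace 1 {:L} (f x) = f (galTrace 1 {:K} x).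
Proof.
have [h [h_inj hG hE]] := gal_bij.
rewrite /galTrace -hG big_imset => [|s t _ _ /h_inj //].
by rewrite rmorph_sum; apply: eq_bigr => s _; rewrite hE.
Qed.

Lemma integers_transport x : ring_of_integers (f x) <-> ring_of_integers x.
Proof.
have [phi _] := algC_embedding L.
by rewrite (ring_of_integersP phi) (ring_of_integersP (phi \o f)).
Qed.

Definition has_discriminant (M : numField) n (d : int) :=
  exists w : n.-tuple M, (basis_of {:M} w /\
    forall x, ring_of_integers x <-> inIntSpan w x) /\
    d%:~R = \det (\matrix_(i < n, j < n) galTrace 1 {:M} (w`_i * w`_j)).

Lemma has_discriminant_transport n d :
  has_discriminant K n d -> has_discriminant L n d.
Proof.
move=> [w [[w_basis ibw] Dd]]; exists [tuple of map f w].
have fw (i : 'I_n) : [tuple of map f w]`_i = f w`_i.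
  by rewrite (nth_map 0) ?size_tuple.
split; first split.
- rewrite basisEdim; apply/andP; split; last first.
    by rewrite size_map dim_transport (size_basis w_basis) ?size_tuple.
  apply/subvP => y _.
  rewrite -(gK y) (coord_basis w_basis (memvf (g y))) rmorph_sum rpred_sum // => i _.
  rewrite (fmorph_numZ f) memvZ // memv_span // -fw.
  by apply: mem_nth; rewrite size_tuple.
- move=> y; rewrite -(gK y) integers_transport ibw; split=> [[c]|[c]].
    move=> ->; exists c; rewrite rmorph_sum; apply: eq_bigr => i _.
    by rewrite rmorphMz fw.
  move=> Dy; exists c; apply: (fmorph_inj f); rewrite Dy rmorph_sum.
  by apply: eq_bigr => i _; rewrite rmorphMz fw.
rewrite -(rmorph_int f) Dd -det_map_mx; congr (\det _).
by apply/matrixP => i j; rewrite !mxE -galTrace_transport rmorphM !fw.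
Qed.

Lemma fractional_ideal_transport (I : set K) :
  fractional_ideal I -> fractional_ideal (f @` I).
Proof.
move=> [[x [Ix x_neq0]] ID IM [d [Zd d_neq0 Id]]]; split.
- by exists (f x); split; [exists x | rewrite fmorph_eq0].
- by move=> _ _ [u Iu <-] [v Iv <-]; exists (u + v); [apply: ID | rewrite rmorphD].
- move=> a _ Za [u Iu <-]; exists (g a * u); last by rewrite rmorphM gK.
  by apply: IM => //; rewrite -integers_transport gK.
exists (f d); split; rewrite ?fmorph_eq0 //; first exact/integers_transport.
by move=> _ [u Iu <-]; rewrite -rmorphM integers_transport; apply: Id.
Qed.

Lemma principal_generator_transport x :
  principal_generator x -> principal_generator (f x).
Proof.
move=> [x_neq0 pos_x]; split; first by rewrite fmorph_eq0.
rewrite dim_transport => dim2 realL phi.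
apply: (pos_x dim2 _ (phi \o f)) => psi y.
by have := realL (psi \o g) (f y); rewrite /= fK.
Qed.

Lemma ideal_equiv_transport (I J : set K) :
  ideal_equiv I J -> ideal_equiv (f @` I) (f @` J).
Proof.
move=> [x [gen_x ->]]; exists (f x); split; first exact: principal_generator_transport.
rewrite !image_comp; apply: eq_imagel => y _ /=.
by rewrite rmorphM.
Qed.

Lemma image_transportK : cancel (fun I : set K => f @` I) (fun I => g @` I).
Proof.
move=> I; rewrite image_comp (eq_imagel (f' := id)) ?image_id // => x _ /=.
by rewrite fK.
Qed.

End Transport.

Section ClassNumber.

Variables (K L : numField) (f : {rmorphism K -> L}) (g : {rmorphism L -> K}).
Hypotheses (fK : cancel f g) (gK : cancel g f).

Let F (I : set K) : set L := f @` I.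
Let G (J : set L) : set K := g @` J.
Let FK : cancel F G := image_transportK fK.
Let GK : cancel G F := image_transportK gK.

Lemma ideal_class_transport I : ideal_class (F I) = F @` ideal_class I.
Proof.
apply/seteqP; split=> [J [frJ eqJ] | _ [J [frJ eqJ] <-]]; last first.
  by split; [exact: (fractional_ideal_transport gK) | exact: (ideal_equiv_transport fK gK)].
exists (G J); last exact: GK.
split; first exact: (fractional_ideal_transport fK).
by rewrite -(FK I); apply: (ideal_equiv_transport gK fK).
Qed.

Lemma class_group_transport :
  @class_group L = (fun C => F @` C) @` @class_group K.
Proof.
apply/seteqP; split=> [_ [J frJ <-] | _ [_ [I frI <-] <-]].
  exists (ideal_class (G J)); last by rewrite -ideal_class_transport GK.
  by exists (G J) => //; apply: (fractional_ideal_transport fK).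
by exists (F I); [exact: (fractional_ideal_transport gK) | rewrite ideal_class_transport].
Qed.

Lemma class_number_transport : class_number L = class_number K.
Proof.
have FFK : cancel (fun C : set (set K) => F @` C) (fun C => G @` C).
  by move=> C; rewrite image_comp (eq_imagel (f' := id)) ?image_id // => x _; apply: FK.
by rewrite /class_number class_group_transport (card_fset_set_image _ FFK).
Qed.

Lemma discriminant_transport : discriminant L = discriminant K.
Proof.
have discE (M : numField) : discriminant M = xget 0 (has_discriminant M (\dim {:M})) by [].
rewrite !discE (dim_transport gK); congr (xget 0 _).
apply/seteqP; split=> d; first exact: (has_discriminant_transport fK).
exact: (has_discriminant_transport gK).
Qed.

End ClassNumber.

Lemma isomorphic_invariants (K L : numField) : isomorphic K L ->
  class_number K = class_number L /\ discriminant K = discriminant L.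
Proof.
move=> [f [g0 fK0 gK0]]; have [g Eg] := rmorphism_inverse fK0 gK0.
have fK : cancel f g by move=> x; rewrite Eg.
have gK : cancel g f by move=> x; rewrite Eg.
by rewrite (class_number_transport fK gK) (discriminant_transport fK gK).
Qed.

End IsomorphismInvariance.

(** * Growth of C_eps *)

Lemma prod_primes_leq m : (0 < m)%N -> (\prod_(q <- primes m) q <= m)%N.
Proof.
move=> m_gt0; rewrite [X in (_ <= X)%N](prod_prime_decomp m_gt0) prime_decompE.
rewrite big_map big_seq [X in (_ <= X)%N]big_seq; apply: leq_prod => q q_m /=.
rewrite -{1}(expn1 q) leq_pexp2l ?logn_gt0 //.
by move: q_m; rewrite mem_primes => /and3P[/prime_gt0].
Qed.

(* There are at most p^k primes below p^k, and each of the others contributes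
   at least p^k to m. *)
Lemma expn_omega_leq (p k m : nat) : (1 < p)%N -> (0 < m)%N ->
  (p ^ (k * omega m) <= p ^ (k * p ^ k) * m)%N.
Proof.
move=> p_gt1 m_gt0; pose small q := (q < p ^ k)%N.
have -> : omega m = (count small (primes m) + count (predC small) (primes m))%N.
  by rewrite count_predC.
rewrite mulnDr expnD; apply: leq_mul.
  rewrite leq_exp2l // leq_mul2l -size_filter; apply/orP; right.
  rewrite -[leqRHS](size_iota 0); apply: uniq_leq_size.
    by rewrite filter_uniq ?primes_uniq.
  by move=> q; rewrite mem_filter mem_iota => /andP[].
apply: leq_trans (prod_primes_leq m_gt0); rewrite expnM.
have : all (leq 1) (primes m).
  by apply/allP => q; rewrite mem_primes => /and3P[/prime_gt0].
elim: (primes m) => [|q r IHr] /=; first by rewrite big_nil.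
move=> /andP[q_gt0 /IHr r_le]; rewrite big_cons /small -leqNgt expnD leq_mul //.
by case: (leqP (p ^ k) q) => [?|_]; rewrite ?expn0 ?expn1.
Qed.

Lemma expn_omega_conductor (K : numField) (p k : nat) :
    prime p -> \dim {:K} = p ->
  (p ^ (k * (omega (conductor K) - 1)) <= p ^ (k * p ^ k) * `|discriminant K|)%N.
Proof.
move=> p_pr dimK.
have [e [e_gal e_inj e_surj e_sum]] := gal_enum K.
have [D_neq0 _] := discriminantP e_gal e_inj e_sum.
apply: leq_trans (expn_omega_leq k (prime_gt1 p_pr) _); last by rewrite absz_gt0.
rewrite leq_exp2l ?prime_gt1 // leq_mul2l leq_subLR; apply/orP; right.
rewrite add1n /omega -/(size (p :: primes `|discriminant K|)).
apply: uniq_leq_size; first exact: primes_uniq.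
move=> q q_f; rewrite inE; case: eqVneq => //= q_neq_p.
have q_pr : prime q by move: q_f; rewrite mem_primes => /andP[].
by rewrite mem_primes q_pr absz_gt0 D_neq0 (conductor_ramified dimK).
Qed.

Lemma successive_maxima_unbounded (R : realType) (X : nat -> R) :
  (forall y, exists i, y < X i) -> forall n, exists y, successive_maxima X n = Some y.
Proof.
move=> unbX n; suff [i Di] : exists i, max_index X n = Some i.
  by exists (X i); rewrite /successive_maxima Di.
elim: n => [|n [i Di]]; first by exists 0%N.
rewrite /= Di /= /next_index; case: pselect => [h|]; last by case.
by exists (ex_minn h).
Qed.

(* The k-th power of H / S^eps is at least S^3, as k >= 3 / eta, while P^k is at
   most a constant times S^2. *)
Lemma C_eps_lower (R : realType) (p k D H P : nat) (eps : R) :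
    let S : R := Num.sqrt D%:R in let eta := (1 - eps) / 2 in
    (0 < D)%N -> 3 <= eta * k%:R ->
    (0 < P)%N -> (P ^ k <= p ^ (k * p ^ k) * D)%N ->
    S `^ (1 - eta) <= H%:R ->
  S <= (H%:R / (P%:R * S `^ eps)) ^+ k * (p ^ (k * p ^ k))%:R.
Proof.
move=> S eta D_gt0 k_ge P_gt0 P_le H_ge.
have S2 : S ^+ 2 = D%:R by rewrite sqr_sqrtr.
have S_ge1 : 1 <= S by rewrite -sqrtr1 ler_sqrt ?ltr0n // ler1n.
have S_gt0 : 0 < S by apply: lt_le_trans S_ge1.
set A : R := (p ^ _)%:R.
have PA : P%:R ^+ k <= A * S ^+ 2 by rewrite S2 -natrX -natrM ler_nat.
have Pk_gt0 : 0 < P%:R ^+ k :> R by rewrite exprn_gt0 ?ltr0n.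
have H_ge' : S `^ eta <= H%:R / S `^ eps.
  rewrite ler_pdivlMr ?powR_gt0 // -powRD; last by rewrite (gt_eqF S_gt0) implybT.
  have -> : eta + eps = 1 - eta by rewrite /eta; field.
  exact: H_ge.
have Hk : S ^+ 3 <= (H%:R / S `^ eps) ^+ k.
  apply: le_trans (_ : (S `^ eta) ^+ k <= _).
    rewrite -(powR_mulrn 3 (ltW S_gt0)) -(powR_mulrn k (powR_ge0 _ _)) -powRrM.
    by rewrite ler_powR.
  by rewrite lerXn2r ?nnegrE ?powR_ge0 // divr_ge0 ?powR_ge0.
have -> : (H%:R / (P%:R * S `^ eps)) ^+ k = (H%:R / S `^ eps) ^+ k / P%:R ^+ k.
  by rewrite invfM mulrCA mulrC exprMn exprVn.
rewrite mulrAC ler_pdivlMr //.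
apply: le_trans (_ : S * (A * S ^+ 2) <= _); first by rewrite ler_pM2l.
rewrite mulrCA -exprS [A * _]mulrC ler_wpM2r //.
Qed.

Theorem theorem2p6 (R : realType) (p : nat) (s : bool) (K : nat -> numField)
    (eps : R) :
  prime p ->
  enumerates_by_conductor (cyclic_family p s) K ->
  (forall eta : R, 0 < eta -> eta < 1 ->
     infinitely_many_fields (fun L => cyclic_family p s L /\
       (class_number L)%:R >= sqrt_disc R L `^ (1 - eta))) ->
  0 < eps -> eps < 1 ->
  forall n, exists y,
    successive_maxima (fun i => C_eps p eps (K i)) n = Some y.
Proof.
move=> p_pr [famK enumK _ _] infH eps_gt0 eps_lt1.
apply: successive_maxima_unbounded => y.
pose eta := (1 - eps) / 2 : R.
have eta_gt0 : 0 < eta by rewrite divr_gt0 // subr_gt0.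
have eta_lt1 : eta < 1 by rewrite ltr_pdivrMr // mul1r; lra.
pose k := Num.bound (3 / eta).
have k_ge : 3 <= eta * k%:R.
  by rewrite mulrC -ler_pdivrMr // ltW // archi_boundP // divr_ge0 // ltW.
pose A : R := (p ^ (k * p ^ k))%:R.
pose d := Num.bound ((`|y| ^+ k * A) ^+ 2).
have [m [Ls LsP]] := hermite_finiteness d p_pr.
have [L [[famL HL] noL]] := infH eta eta_gt0 eta_lt1 m Ls.
have D_gt : (d < `|discriminant L|)%N.
  rewrite ltnNge; apply/negP => D_le; have [dimL _ cycL _] := famL.
  by have [i /noL] := LsP L dimL (cyclic_abelian cycL) D_le.
have [n isoLK] := enumK L famL; exists n.
have [HLK DLK] := isomorphic_invariants isoLK.
rewrite /C_eps /sqrt_disc -HLK -DLK; rewrite /sqrt_disc in HL.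
have [dimK _ _ _] := famK n.
have P_le := expn_omega_conductor k p_pr dimK; rewrite -DLK in P_le.
set P := (p ^ (_ - 1))%N.
have Pk : (P ^ k <= p ^ (k * p ^ k) * `|discriminant L|)%N.
  by rewrite /P -expnM mulnC.
have P_gt0 : (0 < P)%N by rewrite expn_gt0 prime_gt0.
have D_gt0 : (0 < `|discriminant L|)%N by apply: leq_ltn_trans D_gt.
have := C_eps_lower D_gt0 k_ge P_gt0 Pk HL.
set C := _ / _; rewrite ltNge -/A; apply: contraL => C_le; rewrite -ltNge.
have C_ge0 : 0 <= C by rewrite divr_ge0 // mulr_ge0 // powR_ge0.
apply: le_lt_trans (_ : `|y| ^+ k * A < _).
  rewrite ler_wpM2r ?ler0n // lerXn2r ?nnegrE //.
  by apply: le_trans C_le (ler_norm y).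
have A_ge0 : 0 <= `|y| ^+ k * A by rewrite mulr_ge0 ?ler0n // exprn_ge0.
rewrite -[ltLHS]ger0_norm // -sqrtr_sqr ltr_sqrt ?ltr0n //.
apply: lt_trans (archi_boundP (sqr_ge0 _)) _.
by rewrite ltr_nat.
Qed.
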